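(* Let $\theta_1,\dots,\theta_r$ be real numbers, with $d$, $\nu_\theta$ and the random variable $Z_\theta$ as defined in the context. For $1\le j\le D$, let $f_j\in\mathbb{C}(X_1,\dots,X_r)$ be real-valued and without pole on $\mathbb{T}^r$, and let $F_j:t\mapsto f_j(e^{i\theta_1t},\dots,e^{i\theta_rt})$. Then $$\frac1X\#\{n\le X : F_1(n)>\dots>F_D(n)\}\underset{X\to+\infty}{\longrightarrow}\frac1d\sum_{a=0}^{d-1}\mathbb{P}\left(f_1(\nu_\theta^aZ_\theta)>\dots>f_D(\nu_\theta^aZ_\theta)\right).$$
   Context: $\mathbb{T}=\{z\in\mathbb{C}:|z|=1\}$, and $\mathbb{T}^r$ is a group under coordinatewise multiplication. The integers $n\le X$ are positive. A rational function has no pole on $\mathbb{T}^r$ if it can be written $P/Q$ with polynomials $P,Q$ such that $Q$ does not vanish on $\mathbb{T}^r$; it is real-valued on $\mathbb{T}^r$ if it takes real values there. Let $m\ge0$ be defined by $m+1=\dim_{\mathbb{Q}}\mathrm{Span}_{\mathbb{Q}}(\pi,\theta_1,\dots,\theta_r)$. After reindexing the $\theta_i$ (and correspondingly the variables $X_i$), it is assumed that $\{2\pi,\theta_1,\dots,\theta_m\}$ is a basis of this $\mathbb{Q}$-vector space, and one writes $\theta_j=2\pi c_j+\sum_{k=1}^m b_{k,j}\theta_k$ for $m+1\le j\le r$, with $c_j,b_{k,j}\in\mathbb{Q}$. Let $d\ge1$ be the least common multiple of the denominators of all the $c_j$ and $b_{k,j}$ ($d=1$ if $m=r$), $h_{k,j}=d\,b_{k,j}\in\mathbb{Z}$,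 and $\nu_\theta=(e^{i\theta_1},\dots,e^{i\theta_r})$. The random variable $Z_\theta$ with values in $\mathbb{T}^r$: if $m=0$ (degenerate case, all $\theta_i\in\pi\mathbb{Q}$), $Z_\theta$ is uniform on the finite cyclic group $\langle\nu_\theta\rangle$; if $m\ge1$ (non-degenerate case), $Z_\theta=\left(Z_1^d,\dots,Z_m^d,\prod_{k=1}^mZ_k^{h_{k,m+1}},\dots,\prod_{k=1}^mZ_k^{h_{k,r}}\right)$ where $Z_1,\dots,Z_m$ are independent uniform random variables on $\mathbb{T}$. *)

(* Defs.v *)
From HB Require Import structures.
From mathcomp Require Import all_boot all_order all_algebra.
From mathcomp Require Import fraction complex.
(* The notations of mpoly are incompatible with those of MathComp-Analysis. *)
From mathcomp Require Import -(notations) mpoly.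
From mathcomp Require Import finmap.
From mathcomp Require Import all_classical all_reals all_analysis.
Set Implicit Arguments.
Unset Strict Implicit.
Unset Printing Implicit Defensive.
Import Order.TTheory GRing.Theory Num.Theory numFieldNormedType.Exports.
Local Open Scope classical_set_scope.
Local Open Scope ring_scope.
Local Open Scope complex_scope.

Section RationalSpan.
Variable R : realType.

Definition Q_span (I : finType) (e : I -> R) : set R :=
  [set x | exists q : I -> rat, x = \sum_i ratr (q i) * e i].

Definition Q_free (I : finType) (e : I -> R) : Prop :=
  forall q : I -> rat, \sum_i ratr (q i) * e i = 0 -> forall i, q i = 0.

Definition Q_basis (I : finType) (e : I -> R) (V : set R) : Prop :=
  Q_free e /\ Q_span e = V.

(* The family [x; t_0; ...; t_(k-1)], with x at index None. *)
Definition adjoin (k : nat) (x : R) (t : 'I_k -> R) : option 'I_k -> R :=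
  oapp t x.

End RationalSpan.

Section Denominators.
Variables (m n : nat) (c : 'I_n -> rat) (b : 'I_m -> 'I_n -> rat).

Definition denom_lcm : nat :=
  \big[lcmn/1%N]_(j < n)
    lcmn `|denq (c j)| (\big[lcmn/1%N]_(k < m) `|denq (b k j)|%N).

(* denom_lcm * b k j is an integer, hence equal to its numerator. *)
Definition hcoef (k : 'I_m) (j : 'I_n) : int := numq (denom_lcm%:R * b k j).

End Denominators.

Section Torus.
Variable R : realType.

Definition expi (t : R) : R[i] := cos t +i* sin t.

Definition torus (r : nat) : set {ffun 'I_r -> R[i]} :=
  [set z | forall i, `|z i| = 1].

Definition nu (r : nat) (theta : 'I_r -> R) : {ffun 'I_r -> R[i]} :=
  [ffun i => expi (theta i)].

Definition cyclic_subgroup (r : nat) (z : {ffun 'I_r -> R[i]}) :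
    set {ffun 'I_r -> R[i]} :=
  [set w | exists s : int, w = [ffun i => z i ^ s]].

Definition pow_mul (r : nat) (z : {ffun 'I_r -> R[i]}) (a : nat)
    (w : {ffun 'I_r -> R[i]}) : {ffun 'I_r -> R[i]} :=
  [ffun i => z i ^+ a * w i].

End Torus.

Section RationalFunctions.
Variables (R : realType) (r : nat).

Definition ratfun := {fraction mpoly r R[i]}.

(* The value P(z)/Q(z) for a representation f = P/Q with Q(z) != 0; it does not
   depend on the representation (rat_evalE). *)
Definition rat_eval (f : ratfun) (z : {ffun 'I_r -> R[i]}) : R[i] :=
  let PQ := xget (0 : mpoly r R[i], 1 : mpoly r R[i])
    [set PQ | meval z PQ.2 != 0 /\ f = tofrac PQ.1 / tofrac PQ.2] in
  meval z PQ.1 / meval z PQ.2.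

Lemma rat_evalE (P Q : mpoly r R[i]) (z : {ffun 'I_r -> R[i]}) :
  meval z Q != 0 -> rat_eval (tofrac P / tofrac Q) z = meval z P / meval z Q.
Proof.
move=> Qz; rewrite /rat_eval; set S := [set PQ | _].
have /(xgetPex (0, 1)) : exists PQ, S PQ by exists (P, Q).
case: (xget _ _) => P' Q' [/= Q'z E].
have nz (A : mpoly r R[i]) : meval z A != 0 -> tofrac A != 0.
  by apply: contraNneq => /eqP; rewrite tofrac_eq0 => /eqP ->; rewrite meval0.
move/eqP: E; rewrite eqr_div ?nz // -!tofracM tofrac_eq => /eqP E.
apply/eqP; rewrite eqr_div // -!mevalM eq_sym.
by rewrite E.
Qed.

Definition no_pole_on_torus (f : ratfun) : Prop :=
  exists P Q : mpoly r R[i],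
    (forall z, torus z -> meval z Q != 0) /\ f = tofrac P / tofrac Q.

Definition real_on_torus (f : ratfun) : Prop :=
  forall z, torus z -> rat_eval f z \is Num.real.

Definition along_line (f : ratfun) (theta : 'I_r -> R) (t : R) : R[i] :=
  rat_eval f [ffun i => expi (theta i * t)].

End RationalFunctions.

(* v_0 > v_1 > ... > v_(D-1).  The order of R[i] extends that of the reals. *)
Definition decreasing_chain (R : realType) (D : nat) (v : 'I_D -> R[i]) : bool :=
  sorted >%R [seq v j | j <- enum 'I_D].

(* Num.truncn X is the integral part of X for X >= 0. *)
Definition count_upto (R : realType) (A : pred nat) (X : R) : nat :=
  count A (iota 1 (Num.truncn X)).

Section RandomVariables.
Variable R : realType.

(* The measurable structure on complex numbers is that of R * R. *)
Definition reim (z : R[i]) : measurableTypeR R * measurableTypeR R :=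
  (complex.Re z, complex.Im z).

Variables (dO : measure_display) (Omega : measurableType dO).
Variable P : probability Omega R.

Definition torus_rv (r : nat) (Z : Omega -> {ffun 'I_r -> R[i]}) : Prop :=
  (forall w, torus (Z w)) /\
  forall i, measurable_fun setT (fun w => reim (Z w i)).

Definition uniform_on_finite (r : nat) (Z : Omega -> {ffun 'I_r -> R[i]})
    (G : set {ffun 'I_r -> R[i]}) : Prop :=
  finite_set G /\
  forall g, G g -> P (Z @^-1` [set g]) = (#|` fset_set G|%:R^-1)%:E.

(* The law of W is that of e^(2 i pi U), with U uniform on [0, 1]. *)
Definition uniform_on_circle (W : Omega -> R[i]) : Prop :=
  [/\ forall w, `|W w| = 1,
      measurable_fun setT (fun w => reim (W w)) &
      forall B : set (measurableTypeR R * measurableTypeR R), measurable B ->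
        P [set w | B (reim (W w))] =
        uniform_prob (@ltr01 R) [set u | B (reim (expi (2 * pi * u)))]].

(* Taking some of the B k full gives the product rule for subfamilies. *)
Definition independent_family (m : nat) (W : 'I_m -> Omega -> R[i]) : Prop :=
  forall B : 'I_m -> set (measurableTypeR R * measurableTypeR R),
    (forall k, measurable (B k)) ->
    P [set w | forall k, B k (reim (W k w))] =
    (\prod_(k < m) P [set w | B k (reim (W k w))])%E.

Definition torus_monomials (m n : nat) (c : 'I_n -> rat)
    (b : 'I_m -> 'I_n -> rat) (W : 'I_m -> R[i]) : {ffun 'I_(m + n) -> R[i]} :=
  [ffun i : 'I_(m + n) => match fintype.split i with
             | inl k => W k ^+ denom_lcm c b
             | inr j => \prod_(k < m) W k ^ hcoef c b k j
             end].

Definition is_Z_theta (m n : nat) (theta : 'I_(m + n) -> R) (c : 'I_n -> rat)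
    (b : 'I_m -> 'I_n -> rat) (Z : Omega -> {ffun 'I_(m + n) -> R[i]}) : Prop :=
  if m == 0%N then
    torus_rv Z /\ uniform_on_finite Z (cyclic_subgroup (nu theta))
  else
    exists W : 'I_m -> Omega -> R[i],
      [/\ forall k, uniform_on_circle (W k), independent_family W &
          forall w, Z w = torus_monomials c b (W ^~ w)].

End RandomVariables.

(* Main.v *)
Require Import Defs.
From HB Require Import structures.
From mathcomp Require Import all_boot all_order all_algebra.
From mathcomp Require Import complex ring lra zify.
From mathcomp Require Import -(notations) mpoly.
From mathcomp Require Import finmap.
From mathcomp Require Import all_classical all_reals all_analysis measurable_realfun.
Set Implicit Arguments.
Unset Strict Implicit.
Unset Printing Implicit Defensive.
Import Order.TTheory GRing.Theory Num.Theory numFieldNormedType.Exports.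
Local Open Scope classical_set_scope.
Local Open Scope ring_scope.
Local Open Scope complex_scope.

(** Along a residue class n = a + d q modulo d, the point with coordinates
    e^(i theta_j n) is nu^a M(w^q): here w is the point of T^m with coordinates
    e^(i theta_k), the power w^q is taken coordinatewise, and M is the monomial
    map T^m -> T^r that defines Z_theta from (Z_1, ..., Z_m) ([paramE],
    [line_param]).  Hence, for each a, the claim is that the orbit of w on T^m
    visits the set A of all V such that f_1(nu^a M(V)) > ... > f_D(nu^a M(V))
    with frequency P(W in A), where W is uniform on T^m; averaging over a gives
    the theorem ([residue_frequency]).

    After multiplication by the positive squared moduli of the denominators,
    f_i > f_j becomes the positivity on the torus of the real part of a
    polynomial in the coordinates and their conjugates ([chain_positivity]).
    Thus A is the set where g > 0, with g the minimum of finitely many real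
    trigonometric polynomials ([positivity_frequency]).  If one of them vanishes
    identically on T^m, then A is empty.  Otherwise their zero sets, and so the
    set where g = 0, are null ([torus_zeros_negligible]), and two facts suffice.

    - As 2 pi, theta_1, ..., theta_m are free over Q, no nontrivial character is
      trivial at w, so geometric sums show that the sums over q < N of a
      trigonometric polynomial along two orbits V w^q and V' w^q differ by a
      bounded amount.  Real functions that are uniform limits of trigonometric
      polynomials are stable under absolute values, so they include minima and the
      piecewise linear approximations of the indicator functions of half-lines.
      It follows that, for a < b and up to o(N) uniformly in V and V', at most
      as many terms V w^q satisfy g >= b as terms V' w^q satisfy g > a
      ([visit_count_compare]).
    - The law of W is invariant under rotations ([law_rotation]), so the events
      g(W w^q) > a all have the probability of g(W) > a, and a bound on the
      number of those that hold, valid at every sample point, bounds this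
      probability ([sum_prob_le], [sum_prob_ge]).

    Comparing the orbit of 1 with that of W, the frequency of visits to A lies
    within any given error between P(g(W) >= delta) and P(g(W) > - delta), and
    these tend to P(g(W) > 0) as delta decreases to 0 ([visit_frequency]).

    If m = 0, the orbit is periodic, and the average over a of the events
    attached to nu^a Z does not depend on the value of Z in <nu>
    ([coset_average]). *)

(** * Polynomials in the coordinates and their conjugates *)
Section StarPolynomials.
Variable R : realType.
Local Notation C := R[i].

(** On the torus these functions are the trigonometric polynomials; conjugates
    are kept as separate generators so that this class of functions, defined on
    the whole of C^r, is closed under conjugation and real parts. *)
Inductive star_poly (r : nat) : (('I_r -> C) -> C) -> Prop :=
| star_cst c : star_poly (fun _ => c)
| star_coord i : star_poly (fun z => z i)
| star_conj_coord i : star_poly (fun z => conjc (z i))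
| star_add f g : star_poly f -> star_poly g -> star_poly (fun z => f z + g z)
| star_mul f g : star_poly f -> star_poly g -> star_poly (fun z => f z * g z).

Variable r : nat.
Implicit Types f g : ('I_r -> C) -> C.

Lemma star_sum I (s : seq I) (F : I -> ('I_r -> C) -> C) :
  (forall i, star_poly (F i)) -> star_poly (fun z => \sum_(i <- s) F i z).
Proof.
move=> sF; elim: s => [|i s IH].
  by under eq_fun do rewrite big_nil; exact: star_cst.
by under eq_fun do rewrite big_cons; exact: star_add.
Qed.

Lemma star_prod I (s : seq I) (F : I -> ('I_r -> C) -> C) :
  (forall i, star_poly (F i)) -> star_poly (fun z => \prod_(i <- s) F i z).
Proof.
move=> sF; elim: s => [|i s IH].
  by under eq_fun do rewrite big_nil; exact: star_cst.
by under eq_fun do rewrite big_cons; exact: star_mul.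
Qed.

Lemma star_exp f k : star_poly f -> star_poly (fun z => f z ^+ k).
Proof.
move=> sf; elim: k => [|k IH].
  by under eq_fun do rewrite expr0; exact: star_cst.
by under eq_fun do rewrite exprS; exact: star_mul.
Qed.

Lemma star_opp f : star_poly f -> star_poly (fun z => - f z).
Proof.
by move=> sf; under eq_fun do rewrite -mulN1r; exact/star_mul/sf/star_cst.
Qed.

Lemma star_sub f g : star_poly f -> star_poly g -> star_poly (fun z => f z - g z).
Proof. by move=> sf sg; apply/star_add/star_opp. Qed.

Lemma star_meval (P : mpoly r C) : star_poly (fun z => meval z P).
Proof.
under eq_fun do rewrite mevalE; apply: star_sum => mn.
apply: star_mul; first exact: star_cst.
by apply: star_prod => i; apply: star_exp; exact: star_coord.
Qed.

Lemma star_conj f : star_poly f -> star_poly (fun z => conjc (f z)).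
Proof.
elim=> [c|i|i|g h _ sg _ sh|g h _ sg _ sh].
- exact: star_cst.
- exact: star_conj_coord.
- by under eq_fun do rewrite conjcK; exact: star_coord.
- by under eq_fun do rewrite rmorphD; exact: star_add.
- by under eq_fun do rewrite rmorphM; exact: star_mul.
Qed.

Lemma star_real_part f : star_poly f -> star_poly (fun z => (complex.Re (f z))%:C).
Proof.
move=> sf; under eq_fun do rewrite ReJ_add mulrC.
by apply: star_mul; [exact: star_cst|apply: star_add => //; exact: star_conj].
Qed.

Lemma star_horner f (Q : {poly R}) : star_poly f ->
  star_poly (fun z => (Q.[complex.Re (f z)])%:C).
Proof.
move=> /star_real_part sf; elim/poly_ind: Q => [|Q c IH].
  by under eq_fun do rewrite horner0; exact: star_cst.
under eq_fun do rewrite hornerMXaddC rmorphD rmorphM.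
by apply: star_add; [exact: star_mul|exact: star_cst].
Qed.

Definition unitary m (V : 'I_m -> C) : Prop := forall k, `|V k| = 1.

Lemma conjc_unit (z : C) : `|z| = 1 -> conjc z = z^-1.
Proof. by move=> z1; rewrite invc_norm z1 expr1n invr1 mul1r. Qed.

Lemma norm1_neq0 (z : C) : `|z| = 1 -> z != 0.
Proof. by move=> z1; rewrite -normr_gt0 z1. Qed.

Lemma star_bounded f : star_poly f ->
  exists B : C, forall z, unitary z -> `|f z| <= B.
Proof.
elim=> [c|i|i|g h _ [B gB] _ [B' hB]|g h _ [B gB] _ [B' hB]].
- by exists `|c|.
- by exists 1 => z ->.
- by exists 1 => z zU; rewrite normcJ zU.
- exists (B + B') => z zU; apply: le_trans (ler_normD _ _) _.
  by apply: lerD; [exact: gB|exact: hB].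
- exists (B * B') => z zU; rewrite normrM.
  by apply: ler_pM => //; [exact: gB|exact: hB].
Qed.

(** On the torus conj z_i = 1 / z_i, so a power of the product of the
    coordinates clears the conjugates.  The coefficients of q are then the
    Fourier coefficients of f, up to a shift of the frequencies, which allows
    exact computations with a function that is only known on the torus. *)
Lemma star_normal_form f : star_poly f -> exists (s : nat) (q : mpoly r C),
  forall z, unitary z -> (\prod_i z i) ^+ s * f z = meval z q.
Proof.
pose X : mpoly r C := \prod_i mpolyX C (mnm1 i).
have evX (z : 'I_r -> C) k : meval z (X ^+ k) = (\prod_i z i) ^+ k.
  by rewrite rmorphXn /= rmorph_prod /=; under eq_bigr do rewrite mevalXU.
elim=> [c|i|i|g h _ [s [p gp]] _ [t [q hq]]|g h _ [s [p gp]] _ [t [q hq]]].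
- by exists 0, (mpolyC r c) => z _; rewrite expr0 mul1r mevalC.
- by exists 0, (mpolyX C (mnm1 i)) => z _; rewrite expr0 mul1r mevalXU.
- exists 1, (\prod_(j | j != i) mpolyX C (mnm1 j)) => z zU.
  rewrite expr1 (bigD1 i) //= mulrAC conjc_unit // divff ?norm1_neq0 // mul1r.
  by rewrite rmorph_prod /=; under [in RHS]eq_bigr do rewrite mevalXU.
- exists (s + t)%N, (X ^+ t * p + X ^+ s * q) => z zU.
  by rewrite mevalD !mevalM !evX -gp // -hq // exprD; ring.
- exists (s + t)%N, (p * q) => z zU.
  by rewrite mevalM -gp // -hq // exprD; ring.
Qed.

End StarPolynomials.

Lemma star_comp (R : realType) (r m : nat) (f : ('I_r -> R[i]) -> R[i])
    (phi : 'I_r -> ('I_m -> R[i]) -> R[i]) :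
  (forall i, star_poly (phi i)) -> star_poly f ->
  star_poly (fun V => f (fun i => phi i V)).
Proof.
move=> sphi; elim=> [c|i|i|g h _ sg _ sh|g h _ sg _ sh].
- exact: star_cst.
- exact: sphi.
- exact: star_conj.
- exact: star_add.
- exact: star_mul.
Qed.

(** * Rotation invariance of the uniform law on the circle *)
Section UniformRotation.
Variable R : realType.
Local Notation mu := (@lebesgue_measure R).
Local Notation mR := (measurableTypeR R).

Lemma measurable_translation (s : R) :
  measurable_fun setT (fun x : mR => x + s : mR).
Proof.
by apply: measurable_funD;
  [exact: measurable_id|exact: measurable_cst].
Qed.

Lemma lebesgue_measure_translation (s : R) (A : set mR) :
  measurable A -> mu [set x | A (x + s)] = mu A.
Proof.
move=> mA; pose nu := [the {measure set mR -> \bar R} of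
  pushforward mu (fun x : mR => x + s : mR) ].
rewrite [RHS](@lebesgue_measure_unique R (nu (measurable_translation s))) //.
move=> _ [[a b] _ <-] /=; rewrite /pushforward.
have -> : (fun x : mR => x + s : mR) @^-1` `]a, b]%classic =
    `](a - s), (b - s)]%classic.
  by apply/seteqP; split => x /=; rewrite !in_itv /= ltrBlDr lerBrDr.
rewrite !lebesgue_measure_itv /= !lte_fin ltrD2r; case: ifP => // _.
by congr EFin; lra.
Qed.

Lemma measure_split_itv (V : set mR) (a b c : R) : measurable V -> a <= b <= c ->
  mu (V `&` `[a, c[) = (mu (V `&` `[a, b[) + mu (V `&` `[b, c[))%E.
Proof.
move=> mV /andP[ab bc]; rewrite -measureU.
- rewrite -setIUr; congr (mu (_ `&` _)); apply/seteqP; split => x /=;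
  rewrite !in_itv /=.
  + by case: (ltP x b) => xb /andP[-> ->]; [left|right].
  + case=> /andP[ax xc]; first by rewrite ax (lt_le_trans xc bc).
    by rewrite xc (le_trans ab ax).
- exact: measurableI.
- exact: measurableI.
- rewrite -subset0 => x /= [[_]] + [_].
  rewrite !in_itv /= => /andP[_ xb] /andP[bx _].
  by move: (lt_le_trans xb bx); rewrite ltxx.
Qed.

Lemma uniform_probE (U : set mR) : measurable U ->
  uniform_prob (@ltr01 R) U = mu (U `&` `[0, 1[).
Proof.
move=> mU; rewrite /uniform_prob integral_uniform_pdf.
rewrite (eq_integral (fun=> 1%E)); last first.
  by move=> x; rewrite inE => -[_] /=; rewrite in_itv /= /uniform_pdf subr0 invr1 => ->.
rewrite integral_cst ?mul1e //; last exact: measurableI.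
rewrite -(@setUitv1 _ _ (BLeft 0) 1 true) ?bnd_simp // setIUr measureU0 //; try exact: measurableI.
apply: subset_measure0 (lebesgue_measure_set1 (1 : R)) => //; exact: measurableI.
Qed.

Lemma periodic_int (U : set mR) (k : int) :
  (forall u, U (u + 1) = U u) -> forall u, U (u + k%:~R) = U u.
Proof.
move=> U1; have Un (n : nat) u : U (u + n%:R) = U u.
  elim: n u => [|n IH] u; first by rewrite addr0.
  by rewrite -[n.+1]addn1 natrD addrA U1.
case: k => n u; first exact: Un.
by rewrite NegzE mulrNz -(Un n.+1) -pmulrn subrK.
Qed.

(** Lebesgue measure on a period is invariant under translations modulo 1: for
    0 <= s < 1, translating by s moves [0, 1 - s[ to [s, 1[, and translating by
    s - 1 moves [1 - s, 1[ to [0, s[. *)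
Lemma uniform_prob_rotation (U : set mR) (s : R) : measurable U ->
  (forall u, U (u + 1) = U u) ->
  uniform_prob (@ltr01 R) [set u | U (u + s)] = uniform_prob (@ltr01 R) U.
Proof.
move=> mU U1; wlog s01 : s / 0 <= s < 1.
  move=> hw; have /andP[f0 f1] := floor_itv s.
  rewrite -(hw (s - (Num.floor s)%:~R)).
    congr (uniform_prob _ _); apply: eq_set => u.
    by rewrite -(periodic_int (Num.floor s) U1 (u + (_ - _))) addrA subrK.
  by rewrite subr_ge0 f0 ltrBlDr addrC -(intrD _ _ 1).
have /andP[s0 s1] := s01.
have mUs : measurable [set u | U (u + s)].
  by rewrite -[X in measurable X]setTI; exact: (measurable_translation s).
rewrite !uniform_probE //.
rewrite (measure_split_itv _ (b := 1 - s)) //; last by lra.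
rewrite [RHS](measure_split_itv _ (b := s)) //; last by lra.
rewrite addeC; congr (_ + _)%E.
- rewrite -[RHS](lebesgue_measure_translation (s - 1)); last exact: measurableI.
  congr (mu _); apply/seteqP; split => u /=; rewrite !in_itv /= addrA;
    rewrite -[U (u + s - 1)]U1 subrK => -[Uu u1]; split => //; lra.
- rewrite -[RHS](lebesgue_measure_translation s); last exact: measurableI.
  congr (mu _); apply/seteqP; split => u /=; rewrite !in_itv /=;
    move=> -[Uu u1]; split => //; lra.
Qed.

End UniformRotation.

Section ComplexParts.
Variable R : realType.
Implicit Types x y : R[i].

Lemma Re_add x y : complex.Re (x + y) = complex.Re x + complex.Re y.
Proof. by case: x; case: y. Qed.
Lemma Im_add x y : complex.Im (x + y) = complex.Im x + complex.Im y.
Proof. by case: x; case: y. Qed.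
Lemma Re_mul x y : complex.Re (x * y) =
  complex.Re x * complex.Re y - complex.Im x * complex.Im y.
Proof. by case: x; case: y. Qed.
Lemma Im_mul x y : complex.Im (x * y) =
  complex.Re x * complex.Im y + complex.Im x * complex.Re y.
Proof. by case: x; case: y. Qed.
Lemma Re_conjc x : complex.Re (conjc x) = complex.Re x.
Proof. by case: x. Qed.
Lemma Im_conjc x : complex.Im (conjc x) = - complex.Im x.
Proof. by case: x. Qed.

End ComplexParts.

Section ComplexMeasurability.
Variables (R : realType) (d : measure_display) (T : measurableType d).
Local Notation C := R[i].
Implicit Types f g : T -> C.

Definition cmeasurable f := measurable_fun setT (fun t => reim (f t)).

Lemma cmeasurableP f : cmeasurable f <->
  measurable_fun setT (fun t => complex.Re (f t)) /\
  measurable_fun setT (fun t => complex.Im (f t)).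
Proof.
split=> [mf|[mr mi]]; last exact: measurable_fun_pair.
split.
- exact: (measurableT_comp measurable_fst mf).
- exact: (measurableT_comp measurable_snd mf).
Qed.

Lemma cmeasurable_cst (c : C) : cmeasurable (fun=> c).
Proof. exact: measurable_cst. Qed.

Lemma cmeasurable_conj f : cmeasurable f -> cmeasurable (fun t => conjc (f t)).
Proof.
move=> /cmeasurableP[mr mi]; apply/cmeasurableP; split.
- by under eq_fun do rewrite Re_conjc.
- by under eq_fun do rewrite Im_conjc; exact: measurable_funN.
Qed.

Lemma cmeasurableD f g : cmeasurable f -> cmeasurable g ->
  cmeasurable (fun t => f t + g t).
Proof.
move=> /cmeasurableP[fr fi] /cmeasurableP[gr gi]; apply/cmeasurableP; split.
- by under eq_fun do rewrite Re_add; exact: measurable_funD.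
- by under eq_fun do rewrite Im_add; exact: measurable_funD.
Qed.

Lemma cmeasurableM f g : cmeasurable f -> cmeasurable g ->
  cmeasurable (fun t => f t * g t).
Proof.
move=> /cmeasurableP[fr fi] /cmeasurableP[gr gi]; apply/cmeasurableP; split.
- under eq_fun do rewrite Re_mul.
  by apply: measurable_funB;
     exact: measurable_funM.
- under eq_fun do rewrite Im_mul.
  by apply: measurable_funD;
     exact: measurable_funM.
Qed.

Lemma cmeasurable_star r (h : ('I_r -> C) -> C) (V : T -> 'I_r -> C) :
  (forall i, cmeasurable (V ^~ i)) -> star_poly h -> cmeasurable (fun t => h (V t)).
Proof.
move=> mV; elim=> [c|i|i|f g _ mf _ mg|f g _ mf _ mg].
- exact: cmeasurable_cst.
- exact: mV.
- exact: cmeasurable_conj.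
- exact: cmeasurableD.
- exact: cmeasurableM.
Qed.

End ComplexMeasurability.

Section Expi.
Variable R : realType.

Lemma expi_unit (t : R) : `|expi t| = 1.
Proof. by rewrite normc_def /= cos2Dsin2 sqrtr1. Qed.

Lemma expiD (s t : R) : expi (s + t) = expi s * expi t.
Proof. by rewrite /expi cosD sinD; simpc; congr (_ +i* _); ring. Qed.

Lemma expi0 : expi 0 = 1 :> R[i].
Proof. by rewrite /expi cos0 sin0. Qed.

Lemma expiMn (t : R) k : expi (t * k%:R) = expi t ^+ k.
Proof.
elim: k => [|k IH]; first by rewrite mulr0 expi0.
by rewrite mulrSr mulrDr mulr1 expiD IH exprSr.
Qed.

Lemma expi_period (t : R) : expi (t + 2 * pi) = expi t.
Proof. by rewrite expiD mulr_natl /expi cos2pi sin2pi mulr1. Qed.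

Lemma cmeasurable_expi (a : R) :
  cmeasurable (fun u : measurableTypeR R => expi (a * u)).
Proof.
have ma : measurable_fun setT (fun u : measurableTypeR R => a * u : measurableTypeR R).
  by apply: measurable_funM;
    [exact: measurable_cst|exact: measurable_id].
apply/cmeasurableP; split => /=.
- by apply: (measurableT_comp _ ma); apply: continuous_measurable_fun; exact: continuous_cos.
- by apply: (measurableT_comp _ ma); apply: continuous_measurable_fun; exact: continuous_sin.
Qed.

Definition of_reim (x : measurableTypeR R * measurableTypeR R) : R[i] := x.1 +i* x.2.

Lemma reimK : cancel (@reim R) of_reim.
Proof. by case. Qed.

Lemma cmeasurable_of_reim : cmeasurable of_reim.
Proof.
rewrite /cmeasurable (_ : (fun t => _) = idfun); first exact: measurable_id.
by apply/funext => -[].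
Qed.

End Expi.

Section CircleRotation.
Variables (R : realType) (dO : measure_display) (Omega : measurableType dO).
Variable P : probability Omega R.

(** Multiplication by e^(it) is the translation of the angle by t / (2 pi). *)
Lemma circle_rotation (W : Omega -> R[i]) (t : R)
    (B : set (measurableTypeR R * measurableTypeR R)) :
  uniform_on_circle P W -> measurable B ->
  P [set w | B (reim (expi t * W w))] = P [set w | B (reim (W w))].
Proof.
move=> [_ _ WP] mB.
pose B' := [set x | B (reim (expi t * of_reim x))].
have mB' : measurable B'.
  have : cmeasurable (fun x => expi t * @of_reim R x).
    by apply: cmeasurableM; [exact: cmeasurable_cst|exact: cmeasurable_of_reim].
  by move=> /(_ measurableT _ mB); rewrite setTI.
have := WP _ mB'; rewrite (WP _ mB).
rewrite (_ : [set w | B' (reim (W w))] = [set w | B (reim (expi t * W w))]); last first.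
  by apply: eq_set => w; rewrite /B' /= reimK.
move=> ->; pose U := [set u : measurableTypeR R | B (reim (expi (2 * pi * u)))].
rewrite -[RHS](@uniform_prob_rotation R U (t / (2 * pi))).
- congr (uniform_prob _ _); apply: eq_set => u; rewrite /B' /U /= reimK -expiD.
  congr (B (reim (expi _))).
  rewrite [RHS]mulrDr [2 * pi * (t / _)]mulrC divfK 1?addrC //.
  by rewrite mulf_neq0 ?gt_eqF ?pi_gt0.
- have := @cmeasurable_expi R (2 * pi) measurableT _ mB. by rewrite setTI.
- by move=> u; rewrite /U /= mulrDr mulr1 expi_period.
Qed.

End CircleRotation.

(** * Rotation invariance of the law of independent uniform points *)
Section Cvec.
Variables (R : realType) (m : nat).

Definition cvec : Type := 'I_m -> R[i].
HB.instance Definition _ := gen_eqMixin cvec.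
HB.instance Definition _ := gen_choiceMixin cvec.
HB.instance Definition _ := isPointed.Build cvec (fun=> 0).

(** The product sigma-algebra of C^m, generated by the events whose probability
    independence prescribes. *)
Definition boxes : set (set cvec) :=
  [set A | exists2 B : 'I_m -> set (measurableTypeR R * measurableTypeR R),
    (forall k, measurable (B k)) & A = [set V | forall k, B k (reim (V k))]].

Definition mcvec := g_sigma_algebraType boxes.

Lemma boxesI : setI_closed boxes.
Proof.
move=> _ _ [B mB ->] [B' mB' ->]; exists (fun k => B k `&` B' k).
  by move=> k; exact: measurableI.
by apply/seteqP; split=> V /= => [[h h'] k|h]; [split|split=> k; case: (h k)].
Qed.

Lemma boxesT : boxes setT.
Proof.
by exists (fun=> setT); [move=> k; exact: measurableT|apply/seteqP; split].
Qed.

Lemma cmeasurable_coord k : cmeasurable (fun V : mcvec => V k).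
Proof.
move=> _ B mB; rewrite setTI; apply: sub_sigma_algebra.
exists (fun j => if j == k then B else setT) => [j|]; first by case: ifP.
apply/seteqP; split => V /= => [h j|/(_ k)]; last by rewrite eqxx.
by case: eqP => // ->.
Qed.

Lemma measurable_cvec d (T : measurableType d) (V : T -> cvec) :
  (forall k, cmeasurable (V ^~ k)) -> measurable_fun setT (V : T -> mcvec).
Proof.
move=> mV;  apply: (@measurability _ _ T mcvec setT V boxes erefl) => _ [_ [B mB ->] <-]; rewrite setTI.
rewrite (_ : _ @^-1` _ = \bigcap_(k in [set: 'I_m]) [set t | B k (reim (V t k))]).
  by apply: fin_bigcap_measurable => // k _; rewrite -[X in measurable X]setTI; exact: mV.
by apply/seteqP; split => t /= h k; [move=> _|]; exact: h.
Qed.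

End Cvec.

Section LawRotation.
Variables (R : realType) (dO : measure_display) (Omega : measurableType dO).
Variables (P : probability Omega R) (m : nat) (W : 'I_m -> Omega -> R[i]).
Hypothesis W_unif : forall k, uniform_on_circle P (W k).
Hypothesis W_indep : independent_family P W.

Lemma cmeasurable_W k : cmeasurable (W k).
Proof. by case: (W_unif k). Qed.

(** Both laws are probability measures that agree on boxes, by independence and
    by the one-dimensional case, and boxes form a pi-system that generates the
    sigma-algebra. *)
Lemma law_rotation (t : 'I_m -> R) (A : set (mcvec R m)) : measurable A ->
  P [set w | A (fun k => expi (t k) * W k w)] = P [set w | A (W ^~ w)].
Proof.
have mW : measurable_fun setT (fun w => W ^~ w : mcvec R m).
  by apply: measurable_cvec; exact: cmeasurable_W.
have mtW : measurable_fun setT (fun w => (fun k => expi (t k) * W k w) : mcvec R m).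
  apply: measurable_cvec => k; apply: cmeasurableM; first exact: cmeasurable_cst.
  exact: cmeasurable_W.
pose nu1 := [the {measure set (mcvec R m) -> \bar R} of
  pushforward P (fun w => (fun k => expi (t k) * W k w) : mcvec R m) ].
pose nu2 := [the {measure set (mcvec R m) -> \bar R} of
  pushforward P (fun w => W ^~ w : mcvec R m) ].
move=> mA; suff: nu1 mtW A = nu2 mW A by [].
have H := @measure_unique _ R (mcvec R m) (@boxes R m) (fun=> setT) erefl (@boxesI R m) (fun=> @boxesT R m). apply: (H _ (nu1 mtW) (nu2 mW)) => //.
- by rewrite bigcup_const.
- move=> _ [B mB ->]; rewrite /nu1 /nu2 /= /pushforward.
  have mtB k : measurable [set x | B k (reim (expi (t k) * of_reim x))].
    have : cmeasurable (fun x => expi (t k) * @of_reim R x).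
      by apply: cmeasurableM; [exact: cmeasurable_cst|exact: cmeasurable_of_reim].
    by move=> /(_ measurableT _ (mB k)); rewrite setTI.
  have := W_indep mtB; have := W_indep mB => /= -> .
  rewrite (_ : [set w | _] = (fun (w : Omega) k => expi (t k) * W k w) @^-1`
     [set V | forall k, B k (reim (V k))]); last first.
    by apply/seteqP; split => w /= h k; have := h k; rewrite reimK.
  move=> ->; apply: eq_bigr => k _.
  rewrite -(circle_rotation (t k) (W_unif k) (mB k)).
  by congr (P _); apply: eq_set => w; rewrite reimK.
- by move=> _; rewrite /nu1 /= /pushforward preimage_setT probability_setT ltry.
Qed.

End LawRotation.

(** * Counting events and null sets *)
Lemma indic_pred (R : realType) (T : Type) (b : pred T) (x : T) :
  \1_[set y | b y] x = (b x)%:R :> R.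
Proof.
by rewrite indicE (_ : (x \in _) = b x) //; apply/idP/idP; rewrite inE.
Qed.

Section Counting.
Variables (R : realType) (dO : measure_display) (Omega : measurableType dO).
Variables (P : probability Omega R) (N : nat) (E : 'I_N -> pred Omega).
Hypothesis mE : forall q, measurable [set w | E q w].

Let count_measurable : measurable_fun setT (fun w => (\sum_(q < N) (E q w)%:R : R)).
Proof.
apply: measurable_sum => q; rewrite (_ : (fun w => _) = \1_[set w | E q w]).
  exact: measurable_indic.
by apply/funext => w; rewrite indic_pred.
Qed.

Let sum_probE :
  (\sum_(q < N) fine (P [set w | E q w]))%:E =
  (\int[P]_w (\sum_(q < N) (E q w)%:R)%:E)%E.
Proof.
rewrite -sumEFin [RHS](eq_integral (fun w => \sum_(q < N) (\1_[set w | E q w] w)%:E)%E).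
  rewrite ge0_integral_sum //.
  - apply: eq_bigr => q _; rewrite integral_indic // setIT fineK //.
    exact: fin_num_measure.
  - by move=> q; apply/measurable_EFinP; exact: measurable_indic.
move=> w _; rewrite sumEFin; congr EFin; apply: eq_bigr => q _.
by rewrite indic_pred.
Qed.

(** The sum of the probabilities is the mean of the number of events that
    occur. *)
Lemma sum_prob_le (M : R) : 0 <= M -> (forall w, \sum_(q < N) (E q w)%:R <= M) ->
  \sum_(q < N) fine (P [set w | E q w]) <= M.
Proof.
move=> M0 leM.
rewrite -lee_fin sum_probE -[leRHS]mule1 -(probability_setT P) -integral_cst //.
apply: ge0_le_integral => //.
- by move=> w _; rewrite lee_fin sumr_ge0.
- exact/measurable_EFinP.
- by move=> w _; rewrite lee_fin.
Qed.

Lemma sum_prob_ge (M : R) : (forall w, M <= \sum_(q < N) (E q w)%:R) ->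
  M <= \sum_(q < N) fine (P [set w | E q w]).
Proof.
move=> geM; have [M0|M0] := leP 0 M; last first.
  by apply: le_trans (ltW M0) _; apply: sumr_ge0 => q _; exact/fine_ge0/measure_ge0.
rewrite -lee_fin sum_probE -[leLHS]mule1 -(probability_setT P) -integral_cst //.
apply: ge0_le_integral => //; first exact/measurable_EFinP.
by move=> w _; rewrite lee_fin.
Qed.

End Counting.

Lemma digits_inj (M m : nat) (a b : 'I_m -> nat) :
  (forall k, a k < M)%N -> (forall k, b k < M)%N ->
  (\sum_(k < m) a k * M ^ k = \sum_(k < m) b k * M ^ k)%N -> a =1 b.
Proof.
elim: m a b => [|m IH] a b aM bM; first by move=> _ [].
have expand (c : 'I_m.+1 -> nat) : (\sum_(k < m.+1) c k * M ^ k =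
    (\sum_(k < m) c (lift ord0 k) * M ^ k) * M + c ord0)%N.
  rewrite big_ord_recl expn0 muln1 addnC big_distrl /=; congr (_ + _)%N.
  by apply: eq_bigr => k _; rewrite -mulnA -expnSr.
rewrite !expand => eqab; have M0 : (0 < M)%N by apply: leq_ltn_trans (aM ord0).
have e0 : a ord0 = b ord0.
  by have := congr1 (modn^~ M) eqab; rewrite /= !modnMDl !modn_small.
have eS : (fun k => a (lift ord0 k)) =1 (fun k => b (lift ord0 k)).
  apply: IH => //; apply/eqP; rewrite -(eqn_pmul2r M0); apply/eqP.
  by move: eqab; rewrite e0 => /addIn.
by move=> k; case: (unliftP ord0 k) => [j ->|->].
Qed.

(** This provides arbitrarily many distinct points of the circle. *)
Lemma expi_inv_inj (R : realType) : injective (fun i : nat => @expi R i.+1%:R^-1).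
Proof.
move=> i j [eqcos _].
have in0pi (k : nat) : (k.+1%:R^-1 : R) \in `[0, pi].
  rewrite in_itv /= invr_ge0 ler0n /=; apply: le_trans (pi_ge2 R).
  by rewrite (@le_trans _ _ 1) ?invf_le1 ?ler1n.
have /invr_inj /eqP := cos_inj (in0pi i) (in0pi j) eqcos.
by rewrite eqr_nat => /eqP [].
Qed.

Lemma cmeasurable_zeros (R : realType) d (T : measurableType d) (f : T -> R[i]) :
  cmeasurable f -> measurable [set t | f t == 0].
Proof.
move=> /cmeasurableP[mr mi]; rewrite (_ : [set t | _] =
    (fun t => complex.Re (f t) == 0) @^-1` [set true] `&`
    (fun t => complex.Im (f t) == 0) @^-1` [set true]).
  by apply: measurableI; rewrite -[X in measurable X]setTI;
    apply: measurable_fun_eqr => //; exact: measurable_cst.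
apply/seteqP; split => t /=; rewrite eq_complex /=; first by move=> /andP[-> ->].
by case=> -> ->.
Qed.

(** Zero sets of nonzero polynomials are null for the uniform law on the torus.
    Kronecker substitution: multiplying the k-th coordinate by z^(M^k), with M
    larger than all exponents of q, turns distinct monomials of q into distinct
    powers of z.  For a point V with nonzero coordinates, the rotated value of q
    is thus a nonzero polynomial in z, of degree bounded independently of V, so
    V lies in a bounded number of the rotated zero sets.  These can be taken in
    any number K, and all have the same probability, which must be 0. *)
Section NullSets.
Variables (R : realType) (m : nat).
Local Notation C := R[i].
Variable q : mpoly m C.

Let M := (\max_(mn <- msupp q) mdeg mn).+1.
Let weight (mn : multinom m) := (\sum_(k < m) mn k * M ^ k)%N.
Let restriction (V : 'I_m -> C) : {poly C} :=
  \sum_(mn <- msupp q) (mcoeff mn q * \prod_k V k ^+ mn k) *: 'X^(weight mn).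

Let restrictionE V z :
  (restriction V).[z] = meval (fun k => z ^+ (M ^ k) * V k) q.
Proof.
rewrite horner_sum mevalE; apply: eq_bigr => mn _.
rewrite hornerZ hornerXn -mulrA; congr (_ * _).
rewrite /weight -prodrXr -big_split /=; apply: eq_bigr => k _.
by rewrite exprMn -exprM mulnC mulrC [(_ * mn k)%N]mulnC.
Qed.

Let weight_inj : {in msupp q &, injective weight}.
Proof.
have digit mn k : mn \in msupp q -> (mn k < M)%N.
  move=> mnq; rewrite ltnS; apply: leq_trans (leq_bigmax_seq _ mnq _) => //.
  by rewrite mdegE (bigD1 k) //= leq_addr.
move=> mn mn' mnq mn'q eqw; apply/mnmP => k.
apply: (digits_inj (M := M) _ _ eqw) => j; exact: digit.
Qed.

Let restriction_neq0 V : q != 0 -> (forall k, V k != 0) -> restriction V != 0.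
Proof.
move=> q0 V0; have : mlead q \in msupp q by exact: mlead_supp.
move: (mlead q) => mn0 mn0q; apply/eqP => /(congr1 (fun p : {poly C} => p`_(weight mn0))).
rewrite coef0 coef_sum (bigD1_seq mn0) ?msupp_uniq //= [X in _ + X]big_seq_cond [X in _ + X]big1.
  rewrite coefZ coefXn eqxx mulr1 addr0; apply/eqP; rewrite mulf_neq0 //.
    by rewrite -mcoeff_msupp.
  by apply/prodf_neq0 => k _; rewrite expf_neq0.
move=> mn /andP[mnq mnn]; rewrite coefZ coefXn.
case: eqP; last by rewrite mulr0.
by move=> /esym /(weight_inj mnq mn0q) eqmn; rewrite eqmn eqxx in mnn.
Qed.

Let size_restriction V :
  (size (restriction V) <= \max_(mn <- msupp q) (weight mn).+1)%N.
Proof.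
apply: leq_trans (size_sum _ _ _) _; elim/big_ind2: _ => // [a b c d ab cd|mn _].
  by rewrite geq_max !leq_max ab cd orbT.
by apply: leq_trans (size_scale_leq _ _) _; rewrite size_polyXn.
Qed.

Variables (dO : measure_display) (Omega : measurableType dO).
Variables (P : probability Omega R) (W : 'I_m -> Omega -> C).
Hypothesis W_unif : forall k, uniform_on_circle P (W k).
Hypothesis W_indep : independent_family P W.

Lemma torus_zeros_negligible : q != 0 ->
  P [set w | meval (W ^~ w) q == 0] = 0%E.
Proof.
move=> q0; set S := [set w | _]; pose L := (\max_(mn <- msupp q) (weight mn).+1)%N.
pose A : set (mcvec R m) := [set V | meval V q == 0].
pose tt (i k : nat) : R := i.+1%:R^-1 * (M ^ k)%:R.
have WU k w : `|W k w| = 1 by case: (W_unif k).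
have mA : measurable A.
  by apply: cmeasurable_zeros; apply: cmeasurable_star (star_meval q) => k;
    exact: cmeasurable_coord.
have mtW i : cmeasurable (fun w => meval (fun k => expi (tt i k) * W k w) q).
  apply: cmeasurable_star (star_meval q) => k.
  by apply: cmeasurableM; [exact: cmeasurable_cst|exact: (cmeasurable_W W_unif)].
(* K * P(S) <= L for all K forces P(S) = 0, as R is archimedean. *)
suff h K : fine (P S) * K%:R <= L%:R.
  apply/eqP; rewrite -[P S]fineK ?fin_num_measure //; last first.
    by have /cmeasurable_zeros := cmeasurable_star (cmeasurable_W W_unif) (star_meval q).
  rewrite eqe eq_le fine_ge0 ?measure_ge0 // andbT leNgt; apply/negP => p0.
  have := h (Num.bound (L%:R / fine (P S))); apply/negP; rewrite -ltNge mulrC.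
  by rewrite -ltr_pdivrMr // archi_boundP // divr_ge0 // ltW.
have PE (i : 'I_K) : P [set w | meval (fun k => expi (tt i k) * W k w) q == 0] = P S.
  exact: (law_rotation W_unif W_indep _ mA).
rewrite -[K in K%:R]card_ord mulr_natr -sumr_const.
rewrite -(eq_bigr _ (fun i _ => congr1 fine (PE i))).
apply: sum_prob_le => // [i|]; first exact: cmeasurable_zeros.
move=> w; rewrite -natr_sum ler_nat.
rewrite -(big_mkcond (fun i : 'I_K => meval (fun k => expi (tt i k) * W k w) q == 0) (fun=> 1%N)) /=.
rewrite sum1_card cardE -(size_map (fun i : 'I_K => expi i.+1%:R^-1 : C)).
apply: ltnW; apply: leq_trans (size_restriction (W ^~ w)).
apply: max_poly_roots.
- by apply: restriction_neq0 => // k; exact: norm1_neq0.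
- apply/allP => _ /mapP[i + ->]; rewrite mem_enum => E0.
  rewrite rootE restrictionE.
  rewrite (_ : (fun k => _) = (fun k : 'I_m => expi (tt i k) * W k w)) //.
  by apply/funext => k; rewrite /tt expiMn.
- by rewrite map_inj_uniq ?enum_uniq // => i j /expi_inv_inj /val_inj.
Qed.

End NullSets.

(** * Uniform approximation by trigonometric polynomials *)
Section AbsApprox.
Variable R : realType.

(** With t = |x| and p_k the value at x of the k-th iterate, e_k = t - p_k satisfies
    e_(k+1) = e_k (1 - (t + p_k) / 2) <= e_k (1 - t / 2), while
    (1 - t / 2) (1 + (k + 1) t / 2) <= 1 + k t / 2; so e_k (1 + k t / 2) never
    exceeds its initial value t, and e_k <= 2 / k uniformly on [-1, 1]. *)
Let abs_iter := fix it k : {poly R} :=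
  if k is k'.+1 then it k' + 2^-1 *: ('X^2 - it k' ^+ 2) else 0.

Let abs_iter_bound k x : `|x| <= 1 ->
  0 <= (abs_iter k).[x] <= `|x| /\
  (`|x| - (abs_iter k).[x]) * (1 + k%:R * `|x| / 2) <= `|x|.
Proof.
move=> x1; elim: k => [|k [/andP[p0 px] IH]].
  by rewrite /= !horner0 subr0 mul0r mul0r addr0 mulr1 normr_ge0 !lexx.
rewrite /= !hornerE; set p := (abs_iter k).[x] in p0 px IH *.
rewrite -?expr2 (_ : x ^+ 2 = `|x| ^+ 2); last by rewrite real_normK ?num_real.
set t := `|x| in x1 px IH *; have t0 : 0 <= t by rewrite normr_ge0.
split; first by apply/andP; split; nra.
rewrite (mulrS _ k); set K : R := k%:R in IH *; have K0 : 0 <= K by rewrite ler0n.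
apply: le_trans IH.
have e0 : 0 <= t - p by rewrite subr_ge0.
have -> : t - (p + 2^-1 * (t ^+ 2 - p ^+ 2)) = (t - p) * (1 - (t + p) / 2) by ring.
rewrite -mulrA ler_wpM2l //.
apply: (@le_trans _ _ ((1 - t / 2) * (1 + (1 + K) * t / 2))).
  by rewrite ler_wpM2r //; nra.
nra.
Qed.

Lemma poly_approx_norm (B e : R) : 0 < e ->
  exists Q : {poly R}, forall x, `|x| <= B -> `| `|x| - Q.[x]| <= e.
Proof.
move=> e0; pose b := `|B| + 1; have b0 : 0 < b by rewrite ltr_wpDl.
(* k makes the error 2 / k on [-1, 1], rescaled by b, at most e. *)
have [k /andP[k0 ke]] : exists k : nat, (0 < k%:R :> R) && (b * 2 / e < k%:R).
  exists (Num.bound (b * 2 / e)); have h : b * 2 / e < (Num.bound (b * 2 / e))%:R.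
    by apply: archi_boundP; rewrite divr_ge0 ?mulr_ge0 // ltW.
  by rewrite h (le_lt_trans _ h) // divr_ge0 ?mulr_ge0 // ltW.
exists (b *: (abs_iter k \Po (b^-1 *: 'X))) => x xB.
rewrite hornerZ horner_comp hornerZ hornerX; set y := b^-1 * x.
have -> : `|x| = b * `|y|.
  by rewrite normrM gtr0_norm ?invr_gt0 // mulVKf ?gt_eqF.
have y1 : `|y| <= 1.
  rewrite normrM gtr0_norm ?invr_gt0 // mulrC ler_pdivrMr // mul1r.
  by rewrite (le_trans xB) // (le_trans (ler_norm B)) // lerDl.
have [/andP[p0 px] bnd] := abs_iter_bound k y1.
rewrite -mulrBr normrM gtr0_norm // ger0_norm ?subr_ge0 //.
set p := (_).[y] in p0 px bnd *; set t := `|y| in y1 px bnd *.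
have t0 : 0 <= t by rewrite normr_ge0.
have [t00|tn0] := eqVneq t 0.
  by have : t - p = 0 by [lra] => ->; rewrite mulr0 ltW.
have {}t0 : 0 < t by rewrite lt_neqAle eq_sym tn0.
have h : (t - p) * k%:R <= 2.
  rewrite -(ler_pM2r t0); nra.
rewrite -(ler_pM2r k0); apply: (@le_trans _ _ (b * 2)).
  by rewrite -mulrA ler_wpM2l // ltW.
by rewrite -ler_pdivrMl // mulrC ltW // mulrC.
Qed.

End AbsApprox.

(** * Orbits of a free rotation *)
Section Orbit.
Variables (R : realType) (m : nat).
Local Notation C := R[i].
Implicit Types (w V : 'I_m -> C) (h : ('I_m -> C) -> C) (g : ('I_m -> C) -> R).

Definition multiplicatively_free w :=
  forall e : 'I_m -> int, \prod_k w k ^ e k = 1 -> forall k, e k = 0.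

Definition translate w q V : 'I_m -> C := fun k => w k ^+ q * V k.

Lemma translate_unitary w q V : unitary w -> unitary V -> unitary (translate w q V).
Proof. by move=> wU VU k; rewrite normrM normrX wU VU expr1n mulr1. Qed.

Lemma norm_geometric_sum (rho : C) N : `|rho| = 1 -> rho != 1 ->
  `|\sum_(q < N) rho ^+ q| <= 2 / `|1 - rho|.
Proof.
move=> rho1 rhoN; have d0 : 1 - rho != 0 by rewrite subr_eq0 eq_sym.
have -> : \sum_(q < N) rho ^+ q = (1 - rho ^+ N) / (1 - rho).
  have := subrXX 1 rho N; rewrite expr1n => ->.
  rewrite mulrC mulKf //; apply: eq_bigr => i _.
  by rewrite expr1n mul1r.
rewrite normrM normfV ler_wpM2r ?invr_ge0 //.
by apply: le_trans (ler_normB _ _) _; rewrite normr1 normrX rho1 expr1n.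
Qed.

Lemma norm_expz_unit (z : C) (e : int) : `|z| = 1 -> `|z ^ e| = 1.
Proof.
by move=> z1; case: e => j; rewrite ?NegzE -?exprnN -?exprnP ?normfV normrX z1 expr1n ?invr1.
Qed.

Variable w : 'I_m -> C.
Hypothesis wU : unitary w.
Hypothesis w_free : multiplicatively_free w.

(** The mean value c does not depend on the starting point V of the orbit. *)
Definition bounded_discrepancy h := exists c K : C, forall N V, unitary V ->
  `|\sum_(q < N) h (translate w q V) - c *+ N| <= K.

Lemma bounded_discrepancy_sum (I : Type) (s : seq I) (F : I -> ('I_m -> C) -> C) :
  (forall i, bounded_discrepancy (F i)) ->
  bounded_discrepancy (fun V => \sum_(i <- s) F i V).
Proof.
move=> bF; elim: s => [|i s [c [K cK]]].
  exists 0, 0 => N V _; rewrite mul0rn subr0 big1 ?normr0 // => q _.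
  by rewrite big_nil.
have [c' [K' cK']] := bF i; exists (c' + c), (K' + K) => N V VU.
under eq_bigr do rewrite big_cons.
rewrite big_split mulrnDl opprD addrACA /=.
by apply: le_trans (ler_normD _ _) (lerD (cK' _ _ VU) (cK _ _ VU)).
Qed.

(** A trivial character is constant along orbits.  By freeness any other one has
    a value rho different from 1 at w, and the sums along orbits are bounded
    geometric sums of ratio rho. *)
Lemma bounded_discrepancy_character (a : C) (e : 'I_m -> int) :
  bounded_discrepancy (fun V => a * \prod_k V k ^ e k).
Proof.
have norm_char V : unitary V -> `|\prod_k V k ^ e k| = 1.
  move=> VU; rewrite normr_prod big1 // => k _.
  exact: norm_expz_unit.
pose rho := \prod_k w k ^ e k.
have orbitE q V : \prod_k translate w q V k ^ e k = rho ^+ q * \prod_k V k ^ e k.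
  rewrite /rho -prodrXl -big_split /=; apply: eq_bigr => k _.
  by rewrite expfzMl !exprnP exprzAC.
have [rho1|rhoN] := eqVneq rho 1.
  have e0 := w_free rho1; exists a, 0 => N V VU.
  have V1 : \prod_k V k ^ e k = 1 by rewrite big1 // => k _; rewrite e0 expr0z.
  under eq_bigr do rewrite orbitE rho1 expr1n mul1r V1 mulr1.
  by rewrite sumr_const card_ord subrr normr0.
exists 0, (`|a| * (2 / `|1 - rho|)) => N V VU.
rewrite mul0rn subr0; under eq_bigr do rewrite orbitE mulrCA.
rewrite -mulr_suml mulrC !normrM norm_char // mulr1.
by rewrite ler_wpM2l // norm_geometric_sum // norm_char.
Qed.

Lemma star_bounded_discrepancy h : star_poly h -> bounded_discrepancy h.
Proof.
move=> /star_normal_form[s [p hp]].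
have [c [K cK]] := @bounded_discrepancy_sum _ (msupp p) _ (fun mn =>
  bounded_discrepancy_character (mcoeff mn p) (fun k => (mn k : int) - s%:Z)).
(* On the torus h V is the sum of the coefficients of p times the characters
   with exponents mn k - s. *)
exists c, K => N V VU; rewrite (le_trans _ (cK N V VU)) // le_eqVlt.
apply/orP; left; apply/eqP; congr (`|_ - _|); apply: eq_bigr => q _.
have := translate_unitary q wU VU; move: (translate w q V) => {VU}V VU.
have V0 k : V k != 0 by exact: norm1_neq0.
have VN0 : (\prod_i V i) ^+ s != 0 by rewrite expf_neq0 //; apply/prodf_neq0.
apply: (mulfI VN0); rewrite hp // mevalE mulr_sumr; apply: eq_bigr => mn _.
rewrite mulrCA; congr (_ * _); rewrite -prodrXl -big_split /=.
by apply: eq_bigr => k _; rewrite [_ ^+ s]exprnP -expfzDr // addrC subrK.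
Qed.

(** A form of unique ergodicity that compares two orbits, hence does not mention
    the limit of the means and passes to uniform limits at once.  One inequality
    suffices, as V and V' can be exchanged. *)
Definition uniformly_distributed g := forall eps : R, 0 < eps ->
  exists N0, forall N, (N0 <= N)%N -> forall V V', unitary V -> unitary V' ->
  \sum_(q < N) g (translate w q V) <=
  \sum_(q < N) g (translate w q V') + N%:R * eps.

Lemma Re_sum (I : Type) (s : seq I) (F : I -> C) :
  complex.Re (\sum_(i <- s) F i) = \sum_(i <- s) complex.Re (F i).
Proof. by elim: s => [|i s IH]; rewrite ?big_nil // !big_cons Re_add IH. Qed.

Lemma Re_le_norm (z a : C) : `|z| <= a -> complex.Re z <= complex.Re a.
Proof.
move=> za; have := le_trans (normc_ge_Re z) za.
by rewrite lecE => /andP[_]; apply: le_trans; exact: ler_norm.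
Qed.

Lemma abs_Re_le_norm (z a : C) : `|z| <= a -> `|complex.Re z| <= complex.Re a.
Proof.
move=> za; have := le_trans (normc_ge_Re z) za.
by rewrite lecE => /andP[_].
Qed.

Definition trig_approximable g := forall eps : R, 0 < eps -> exists2 h,
  star_poly h & forall V, unitary V -> `|g V - complex.Re (h V)| <= eps.

Lemma trig_approximable_distributed g :
  trig_approximable g -> uniformly_distributed g.
Proof.
move=> ag eps eps0; have [|h sh gh] := ag (eps / 3); first by rewrite divr_gt0.
have [c [K cK]] := star_bounded_discrepancy sh.
(* K + K bounds the difference of the sums of h along two orbits. *)
pose k := complex.Re (K + K).
have hdiff N V V' : unitary V -> unitary V' ->
  \sum_(q < N) complex.Re (h (translate w q V)) <=
  \sum_(q < N) complex.Re (h (translate w q V')) + k.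
  move=> VU V'U; rewrite -!Re_sum -lerBlDl.
  set x := \sum_(i <- _) _; set y := \sum_(i <- _) _.
  have : `|x - y| <= K + K.
    rewrite -(subrKA (c *+ N)) (le_trans (ler_normD _ _)) // lerD //.
      exact: cK.
    by rewrite distrC; exact: cK.
  by move/Re_le_norm; rewrite Re_add -[y]opprK; case: (y) => y1 y2 /=; rewrite ?opprK.
exists (Num.bound (3 * `|k| / eps)) => N N0 V V' VU V'U.
have kN : k <= N%:R * (eps / 3).
  have : 3 * `|k| / eps < N%:R.
    apply: lt_le_trans (archi_boundP _) _; last by rewrite ler_nat.
    by rewrite divr_ge0 ?mulr_ge0 // ltW.
  rewrite ltr_pdivrMr // => /ltW; have := ler_norm k; lra.
have near V1 : unitary V1 ->
  `|\sum_(q < N) g (translate w q V1) -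
   \sum_(q < N) complex.Re (h (translate w q V1))| <= N%:R * (eps / 3).
  move=> V1U; rewrite -sumrB (le_trans (ler_norm_sum _ _ _)) //.
  rewrite mulr_natl -[X in _ *+ X](card_ord N) -sumr_const ler_sum // => q _.
  exact/gh/translate_unitary.
move: (near _ VU) (near _ V'U) (hdiff N _ _ VU V'U).
rewrite !ler_norml => /andP[_ +] /andP[+ _]; lra.
Qed.

End Orbit.

(** * Comparison of the numbers of visits *)
Section TrigApproximable.
Variables (R : realType) (m : nat).
Implicit Types (f g : ('I_m -> R[i]) -> R).

Lemma trig_approximable_Re (h : ('I_m -> R[i]) -> R[i]) :
  star_poly h -> trig_approximable (fun V => complex.Re (h V)).
Proof.
by move=> sh eps eps0; exists h => // V _; rewrite subrr normr0 ltW.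
Qed.

Lemma trig_approximable_cst (c : R) : @trig_approximable R m (fun=> c).
Proof. exact: (trig_approximable_Re (star_cst _ c%:C)). Qed.

Lemma trig_approximableD f g : trig_approximable f -> trig_approximable g ->
  trig_approximable (fun V => f V + g V).
Proof.
move=> af ag eps eps0.
have [|h sh fh] := af (eps / 2); first by rewrite divr_gt0.
have [|h' sh' gh'] := ag (eps / 2); first by rewrite divr_gt0.
exists (fun V => h V + h' V); first exact: star_add.
move=> V VU; rewrite Re_add opprD addrACA (le_trans (ler_normD _ _)) //.
by rewrite [leRHS](splitr eps) lerD ?fh ?gh'.
Qed.

Lemma trig_approximableZ (c : R) f : trig_approximable f ->
  trig_approximable (fun V => c * f V).
Proof.
move=> af eps eps0; have c1 : 0 < `|c| + 1 by rewrite ltr_wpDl.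
have [|h sh fh] := af (eps / (`|c| + 1)); first by rewrite divr_gt0.
exists (fun V => c%:C * h V); first exact/star_mul/sh/star_cst.
move=> V VU; rewrite Re_mul /= mul0r subr0 -mulrBr normrM.
rewrite (le_trans (ler_pM _ _ (lexx _) (fh V VU))) //.
by rewrite mulrCA ler_piMr ?(ltW eps0) // ler_pdivrMr // mul1r lerDl.
Qed.

(** Absolute values and linear combinations generate minima and piecewise linear
    functions. *)
Lemma trig_approximable_norm f : trig_approximable f ->
  trig_approximable (fun V => `|f V|).
Proof.
move=> af eps eps0; have e2 : 0 < eps / 2 by rewrite divr_gt0.
have [h sh fh] := af _ e2; have [B hB] := star_bounded sh.
have [Q hQ] := poly_approx_norm (complex.Re B) e2.
exists (fun V => (Q.[complex.Re (h V)])%:C); first exact: star_horner.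
move=> V VU /=; rewrite -(subrKA `|complex.Re (h V)|) (le_trans (ler_normD _ _)) //.
rewrite [leRHS](splitr eps) lerD //.
  by rewrite (le_trans (ler_dist_dist _ _)) ?fh.
by apply/hQ/abs_Re_le_norm/hB.
Qed.

Lemma trig_approximable_min f g : trig_approximable f -> trig_approximable g ->
  trig_approximable (fun V => Num.min (f V) (g V)).
Proof.
move=> af ag; (* min x y = (x + y - |x - y|) / 2 *)
rewrite (_ : (fun V => _) =
    (fun V => 2^-1 * (f V + g V + -1 * `|f V + -1 * g V|))).
  do ![apply: trig_approximableZ|apply: trig_approximableD|
       apply: trig_approximable_norm|assumption].
apply/funext => V; rewrite !mulN1r; case: leP => fg.
  by rewrite ler0_norm ?subr_le0 //; lra.
by rewrite ger0_norm ?subr_ge0 1?ltW //; lra.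
Qed.

Lemma trig_approximable_bigmin (I : Type) (s : seq I)
    (F : I -> ('I_m -> R[i]) -> R) (c : R) :
  (forall i, trig_approximable (F i)) ->
  trig_approximable (fun V => \big[Num.min/c]_(i <- s) F i V).
Proof.
move=> aF; elim: s => [|i s IH].
  by under eq_fun do rewrite big_nil; exact: trig_approximable_cst.
by under eq_fun do rewrite big_cons; exact: trig_approximable_min.
Qed.

(** The continuous function equal to 0 up to a, to 1 from b on, and affine in
    between. *)
Definition ramp (a b x : R) : R :=
  2^-1 * (1 + (`|(b - a)^-1 * (x - a)| + -1 * `|(b - a)^-1 * (x - a) + -1|)).

Lemma ramp_bounds (a b x : R) : a < b -> (b <= x)%R%:R <= ramp a b x <= (a < x)%R%:R.
Proof.
move=> ab; rewrite /ramp; set y := (b - a)^-1 * (x - a).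
have ba : 0 < b - a by rewrite subr_gt0.
have yb : (b <= x) = (1 <= y) by rewrite /y ler_pdivlMl // mulr1 lerD2r.
have ya : (a < x) = (0 < y) by rewrite /y pmulr_rgt0 ?invr_gt0 // subr_gt0.
rewrite yb ya; clearbody y.
case: (leP 1 y) => y1; case: (ltP 0 y) => y0; rewrite ?mulr1n ?mulr0n; try lra.
- by rewrite (gtr0_norm y0) ger0_norm; lra.
- by rewrite (gtr0_norm y0) ltr0_norm; lra.
- by rewrite (ler0_norm y0) ltr0_norm; lra.
Qed.

Lemma trig_approximable_ramp a b f : trig_approximable f ->
  trig_approximable (fun V => ramp a b (f V)).
Proof.
move=> af; have ay : trig_approximable (fun V => (b - a)^-1 * (f V - a)).
  apply: trig_approximableZ; apply: trig_approximableD => //.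
  exact: trig_approximable_cst.
have aN : trig_approximable (fun V => (b - a)^-1 * (f V - a) + -1).
  by apply: trig_approximableD => //; exact: trig_approximable_cst.
apply: trig_approximableZ; apply: trig_approximableD.
  exact: trig_approximable_cst.
apply: trig_approximableD; first exact: trig_approximable_norm.
by apply: trig_approximableZ; exact: trig_approximable_norm.
Qed.

Variable w : 'I_m -> R[i].
Hypothesis wU : unitary w.
Hypothesis w_free : multiplicatively_free w.

(** A ramp between a and b lies above the indicator function of [b, +oo[ and
    below that of ]a, +oo[. *)
Lemma visit_count_compare g (a b eps : R) : trig_approximable g -> a < b -> 0 < eps ->
  exists N0, forall N, (N0 <= N)%N -> forall V V', unitary V -> unitary V' ->
  \sum_(q < N) (b <= g (translate w q V))%R%:R <=
  \sum_(q < N) (a < g (translate w q V'))%R%:R + N%:R * eps.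
Proof.
move=> ag ab eps0.
have [N0 hN0] := trig_approximable_distributed wU w_free
  (trig_approximable_ramp a b ag) eps0.
exists N0 => N /hN0 hN V V' VU V'U.
apply: le_trans (le_trans (hN V V' VU V'U) _).
  by apply: ler_sum => q _; have /andP[] := ramp_bounds (g (translate w q V)) ab.
rewrite lerD2r.
by apply: ler_sum => q _; have /andP[] := ramp_bounds (g (translate w q V')) ab.
Qed.

End TrigApproximable.

(** * Frequency of visits to a set of positivity *)
Section Equidistribution.
Variables (R : realType) (m : nat).
Variables (dO : measure_display) (Omega : measurableType dO).
Variables (P : probability Omega R) (W : 'I_m -> Omega -> R[i]).
Hypothesis W_unif : forall k, uniform_on_circle P (W k).
Hypothesis W_indep : independent_family P W.
Variable t : 'I_m -> R.
Let w k := expi (t k).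
Hypothesis w_free : multiplicatively_free w.
Variable g : ('I_m -> R[i]) -> R.
Hypothesis g_approx : trig_approximable g.
Hypothesis g_meas : measurable_fun setT (g : mcvec R m -> R).
Hypothesis g_null : P [set x | g (W ^~ x) == 0] = 0%E.

Let wU : unitary w. Proof. by move=> k; exact: expi_unit. Qed.

Let WU x : unitary (W ^~ x).
Proof. by move=> k; case: (W_unif k). Qed.

Let gW_meas : measurable_fun setT (fun x => g (W ^~ x)).
Proof.
apply: (measurableT_comp g_meas).
by apply: measurable_cvec; exact: cmeasurable_W.
Qed.

Let gqW_meas q : measurable_fun setT (fun x => g (translate w q (W ^~ x))).
Proof.
apply: (measurableT_comp g_meas); apply: measurable_cvec => k.
by apply: cmeasurableM; [exact: cmeasurable_cst|exact: (cmeasurable_W W_unif)].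
Qed.

Let prob_translate (b : pred R) q :
  measurable_fun setT (fun V : mcvec R m => b (g V)) ->
  P [set x | b (g (translate w q (W ^~ x)))] = P [set x | b (g (W ^~ x))].
Proof.
move=> mb; have mA : measurable [set V : mcvec R m | b (g V)].
  by have := mb measurableT [set true] I; rewrite setTI; apply.
rewrite -(law_rotation W_unif W_indep (fun k => t k * q%:R) mA).
by congr (P _); apply: eq_set => x; congr (is_true (b (g _))); apply/funext => k;
  rewrite expiMn.
Qed.

Let gW_ball_meas (delta : R) : measurable [set x | `|g (W ^~ x)| < delta].
Proof.
rewrite -[X in measurable X]setTI.
apply: (measurable_fun_ltr (f := fun x => `|g (W ^~ x)|)) => //.
- by apply: measurableT_comp => //; exact: gW_meas.
Qed.

(** Continuity of the probability along the decreasing events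
    |g(W)| < 1 / (n + 1), whose intersection is null. *)
Lemma prob_near_zero (eps : R) : 0 < eps ->
  exists2 delta : R, 0 < delta & fine (P [set x | `|g (W ^~ x)| < delta]) <= eps.
Proof.
move=> eps0; pose F (n : nat) := [set x | `|g (W ^~ x)| < n.+1%:R^-1].
have capF : \bigcap_n F n = [set x | g (W ^~ x) == 0].
  apply/seteqP; split => x /=; last first.
    by move=> /eqP gx0 n _; rewrite /F /= gx0 normr0 invr_gt0.
  move=> Fx; apply: contraT; rewrite -normr_gt0 => gx0.
  have := Fx (Num.bound `|g (W ^~ x)|^-1) I; rewrite /F /= ltNge => /negP[].
  rewrite invf_ple ?posrE // ltW //.
  apply: lt_le_trans (archi_boundP _) _; first by rewrite invr_ge0.
  by rewrite ler_nat.
have : (P \o F) x @[x --> \oo] --> 0%E.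
  rewrite -g_null -capF; apply: nonincreasing_cvg_mu.
  - by rewrite (le_lt_trans (probability_le1 _ _)) ?ltry //; exact: gW_ball_meas.
  - by move=> n; exact: gW_ball_meas.
  - by apply: bigcapT_measurable => n; exact: gW_ball_meas.
  - move=> n n' nn'; apply/subsetPset => x /= h; apply: lt_le_trans h _.
    by rewrite lef_pV2 ?posrE // ler_nat.
move=> /fine_cvg /cvgrPdist_le /(_ _ eps0)[n _ /(_ n (leqnn n))] /=.
rewrite sub0r normrN => h; exists n.+1%:R^-1; first by rewrite invr_gt0.
exact: le_trans (ler_norm _) h.
Qed.

Lemma fine_prob_subU (A B C : set Omega) : measurable A -> measurable B ->
  measurable C -> A `<=` B `|` C -> fine (P A) <= fine (P B) + fine (P C).
Proof.
move=> mA mB mC ABC.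
have fP D : measurable D -> P D \is a fin_num by exact: fin_num_measure.
rewrite -fineD ?fP //; apply: fine_le; rewrite ?fin_numD ?fP //.
apply: (@le_trans _ _ (P (B `|` C))); last exact: measureU2.
by apply: le_measure; rewrite ?inE //; exact: measurableU.
Qed.

(** The orbit starting at 1 is compared with the orbit starting at the random
    point W.  The events attached to the latter all have the same probability,
    so the counts become multiples of N. *)
Lemma visit_frequency (eps : R) : 0 < eps ->
  exists N0, forall N, (N0 <= N)%N ->
  `|\sum_(q < N) (0 < g (fun k => w k ^+ q))%R%:R -
    N%:R * fine (P [set x | 0 < g (W ^~ x)])| <= N%:R * eps.
Proof.
move=> eps0; have e2 : 0 < eps / 2 by rewrite divr_gt0.
have [delta d0 Pd] := prob_near_zero e2.
have [N1 hN1] := visit_count_compare wU w_free g_approx d0 e2.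
have dN0 : - delta < 0 by rewrite oppr_lt0.
have [N2 hN2] := visit_count_compare wU w_free g_approx dN0 e2.
exists (maxn N1 N2) => N; rewrite geq_max => /andP[/hN1 {}hN1 /hN2 {}hN2].
pose one : 'I_m -> R[i] := fun=> 1.
have oneU : unitary one by move=> k; rewrite normr1.
have translate1 q : translate w q one = (fun k => w k ^+ q).
  by apply/funext => k; rewrite /translate mulr1.
pose S : R := \sum_(q < N) (0 < g (fun k => w k ^+ q))%R%:R.
have m_le b : measurable_fun setT (fun V : mcvec R m => b <= g V).
  by apply: measurable_fun_ler => //; exact: measurable_cst.
have m_lt b : measurable_fun setT (fun V : mcvec R m => b < g V).
  by apply: measurable_fun_ltr => //; exact: measurable_cst.
have ms_le b q : measurable [set x | b <= g (translate w q (W ^~ x))].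
  by rewrite -[X in measurable X]setTI; apply: measurable_fun_ler => //; exact: measurable_cst.
have ms_lt b q : measurable [set x | b < g (translate w q (W ^~ x))].
  by rewrite -[X in measurable X]setTI; apply: measurable_fun_ltr => //; exact: measurable_cst.
have natmul_sum (x : R) : N%:R * x = \sum_(q < N) x.
  by rewrite sumr_const card_ord mulr_natl.
have upper : S - N%:R * (eps / 2) <=
    N%:R * fine (P [set x | - delta < g (W ^~ x)]).
  rewrite [leRHS]natmul_sum.
  have PE (q : 'I_N) : P [set x | - delta < g (translate w q (W ^~ x))] =
    P [set x | - delta < g (W ^~ x)] := prob_translate q (m_lt (- delta)).
  rewrite [leRHS](eq_bigr (fun q : 'I_N => fine (P [set x | - delta < g (translate w q (W ^~ x))])));
    last by move=> q _; exact: (congr1 fine (esym (PE q))).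
  apply: (@sum_prob_ge _ _ _ P N (fun q x => - delta < g (translate w (nat_of_ord q) (W ^~ x)))) => // x.
  rewrite lerBlDr; apply: le_trans (hN2 one _ oneU (WU x)).
  apply: ler_sum => q _; rewrite translate1 ler_nat.
  by case: ltP => // /ltW ->.
have lower : N%:R * fine (P [set x | delta <= g (W ^~ x)]) <=
    S + N%:R * (eps / 2).
  rewrite [leLHS]natmul_sum.
  have PE (q : 'I_N) : P [set x | delta <= g (translate w q (W ^~ x))] =
    P [set x | delta <= g (W ^~ x)] := prob_translate q (m_le delta).
  rewrite [leLHS](eq_bigr (fun q : 'I_N => fine (P [set x | delta <= g (translate w q (W ^~ x))])));
    last by move=> q _; exact: (congr1 fine (esym (PE q))).
  apply: (@sum_prob_le _ _ _ P N (fun q x => delta <= g (translate w (nat_of_ord q) (W ^~ x)))) => //.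
    by rewrite addr_ge0 ?sumr_ge0 // mulr_ge0 // ltW.
  move=> x; apply: le_trans (hN1 _ one (WU x) oneU) _.
  by under eq_bigr do rewrite translate1.
pose p := fine (P [set x | 0 < g (W ^~ x)]).
have mW_le b : measurable [set x | b <= g (W ^~ x)].
  by rewrite -[X in measurable X]setTI; apply: measurable_fun_ler => //; exact: measurable_cst.
have mW_lt b : measurable [set x | b < g (W ^~ x)].
  by rewrite -[X in measurable X]setTI; apply: measurable_fun_ltr => //; exact: measurable_cst.
have p1 : fine (P [set x | - delta < g (W ^~ x)]) <= p + eps / 2.
  apply: le_trans (lerD (lexx p) Pd); apply: fine_prob_subU => // x /= gx.
  have [gd|gd] := ltP (g (W ^~ x)) delta; first by right; rewrite ltr_norml gx.
  by left; exact: lt_le_trans gd.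
have p2 : p <= fine (P [set x | delta <= g (W ^~ x)]) + eps / 2.
  apply: le_trans (lerD (lexx _) Pd); apply: fine_prob_subU => // x /= gx.
  have [gd|gd] := ltP (g (W ^~ x)) delta; last by left.
  by right; rewrite gtr0_norm.
have N0 : 0 <= N%:R :> R by rewrite ler0n.
rewrite -/S -/p ler_norml; apply/andP; split; nra.
Qed.

End Equidistribution.

(** * Chains of values of rational functions *)
Section Chains.
Variable R : realType.
Local Notation C := R[i].

Lemma decreasing_chainE D (v : 'I_D -> C) :
  decreasing_chain v =
  [forall p : 'I_D * 'I_D, (p.1.+1 == p.2 :> nat) ==> (v p.2 < v p.1)].
Proof.
have vnth (i : 'I_D) : nth 0 [seq v j | j <- enum 'I_D] i = v i.
  by rewrite (nth_map i) ?size_enum_ord // nth_ord_enum.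
apply/(sortedP 0)/forallP => /= [h [i j] /=|h i].
  apply/implyP => /eqP ij; have := h i.
  by rewrite size_map size_enum_ord ij !vnth; apply.
rewrite size_map size_enum_ord => iD.
have := h (Ordinal (ltnW iD), Ordinal iD); rewrite /= eqxx /=.
by rewrite -!vnth.
Qed.

Variable r : nat.

(** For f = P / Q and g = P' / Q', the function h is (f - g) |Q|^2 |Q'|^2, in
    which no division remains. *)
Lemma rat_gt_positivity (f g : ratfun R r) :
  no_pole_on_torus f -> no_pole_on_torus g ->
  real_on_torus f -> real_on_torus g ->
  exists2 h, star_poly h & forall z : {ffun 'I_r -> C}, torus z ->
    (rat_eval g z < rat_eval f z) = (0 < complex.Re (h z)).
Proof.
move=> [P [Q [Q0 ->]]] [P' [Q' [Q'0 ->]]] rf rg.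
pose c (A : mpoly r C) (z : 'I_r -> C) := meval z A * conjc (meval z A).
have sc A : star_poly (c A).
  by apply: star_mul; [|apply: star_conj]; exact: star_meval.
exists (fun z => meval z P * conjc (meval z Q) * c Q' z
               - meval z P' * conjc (meval z Q') * c Q z).
  by apply: star_sub; apply: star_mul => //; apply: star_mul;
    [|apply: star_conj| |apply: star_conj]; exact: star_meval.
move=> z Tz; move: (rf z Tz) (rg z Tz); rewrite !rat_evalE ?Q0 ?Q'0 //.
move: (Q0 z Tz) (Q'0 z Tz).
set p := meval z P; set q := meval z Q; set p' := meval z P'; set q' := meval z Q'.
move=> q0 q'0 fR gR.
have c0 : 0 < (q * conjc q) * (q' * conjc q').
  by apply: mulr_gt0; rewrite -sqr_normc exprn_gt0 // normr_gt0.
have -> : p * conjc q * c Q' z - p' * conjc q' * c Q z =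
    ((q * conjc q) * (q' * conjc q')) * (p / q - p' / q').
  rewrite /c -/q -/q'; field; rewrite q0 q'0 //.
rewrite -subr_gt0 -(pmulr_rgt0 _ c0).
have : (q * conjc q) * (q' * conjc q') * (p / q - p' / q') \is Num.real.
  by rewrite realM ?realB // gtr0_real.
by move=> /complex_realP[x ->]; rewrite ltcR.
Qed.

(** Only consecutive indices are compared; the other pairs get the constant 1,
    whose positivity holds trivially. *)
Lemma chain_positivity D (f : 'I_D -> ratfun R r) :
  (forall j, no_pole_on_torus (f j)) -> (forall j, real_on_torus (f j)) ->
  exists2 h : 'I_D * 'I_D -> ('I_r -> C) -> C, forall p, star_poly (h p) &
    forall z : {ffun 'I_r -> C}, torus z ->
    decreasing_chain (fun j => rat_eval (f j) z) =
    [forall p, 0 < complex.Re (h p z)].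
Proof.
move=> npf rf.
have [h sh hE] := all_sig2 (fun p : 'I_D * 'I_D =>
  cid2 (rat_gt_positivity (npf p.1) (npf p.2) (rf p.1) (rf p.2))).
exists (fun p : 'I_D * 'I_D => if p.1.+1 == p.2 :> nat then h p else fun=> 1).
  by move=> p; case: ifP => // _; exact: star_cst.
move=> z Tz; rewrite decreasing_chainE; apply: eq_forallb => p.
by case: ifP => _ /=; rewrite ?hE //= ltr01.
Qed.

End Chains.

(** * Angles and freeness *)
Section Angles.
Variable R : realType.

Lemma expi_sum (I : Type) (s : seq I) (F : I -> R) :
  expi (\sum_(i <- s) F i) = \prod_(i <- s) expi (F i).
Proof.
elim: s => [|i s IH]; first by rewrite !big_nil expi0.
by rewrite !big_cons expiD IH.
Qed.

Lemma expiN (t : R) : expi (- t) = (expi t)^-1.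
Proof.
have e0 : expi t != 0 by apply: norm1_neq0; exact: expi_unit.
by apply: (mulfI e0); rewrite -expiD subrr expi0 divff.
Qed.

Lemma expiMz (t : R) (e : int) : expi (e%:~R * t) = expi t ^ e.
Proof.
case: e => k; first by rewrite mulrC -pmulrn expiMn.
by rewrite NegzE mulrNz mulNr expiN mulrC -pmulrn expiMn.
Qed.

Lemma expi_2piz (e : int) : expi (2 * pi * e%:~R) = 1 :> R[i].
Proof.
by rewrite mulrC expiMz -[2 * pi]add0r expi_period expi0 exp1rz.
Qed.

Lemma expi_eq1 (t : R) : expi t = 1 -> exists e : int, t = 2 * pi * e%:~R.
Proof.
move=> t1; have pi2 : 0 < 2 * pi :> R by rewrite mulr_gt0 ?pi_gt0.
have /andP[f0 f1] := floor_itv (t / (2 * pi)).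
set e := Num.floor _ in f0 f1; exists e.
(* Reduce t to s in [0, 2 pi[, where s and 2 pi - s have the same cosine. *)
pose s := t - 2 * pi * e%:~R.
have s0 : 0 <= s by rewrite subr_ge0 -ler_pdivlMl // mulrC.
have s2 : s < 2 * pi.
  by rewrite ltrBlDl -[X in _ < _ + X]mulr1 -mulrDr -ltr_pdivrMl // mulrC -(intrD _ _ 1).
have [c1 _] : expi s = 1.
  by rewrite expiD t1 mul1r -mulrN -mulrNz expi_2piz.
have pi0 := pi_gt0 R.
suff : s = 0 by move=> /eqP; rewrite subr_eq0 => /eqP.
have [spi|spi] := leP s pi.
  apply: cos_inj; rewrite ?in_itv /= ?lexx ?s0 ?spi ?ltW //.
  by rewrite c1 cos0.
have : 2 * pi - s = 0.
  apply: cos_inj; rewrite ?in_itv /= ?lexx ?(ltW pi0) //; first by apply/andP; split; lra.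
  by rewrite cosB mulr_natl cos2pi sin2pi mul1r mul0r addr0 c1 cos0.
lra.
Qed.

(** A relation between the numbers e^(i theta_k) is an integral relation between
    the theta_k and 2 pi. *)
Lemma Q_free_multiplicatively_free m (theta : 'I_m -> R) :
  Q_free (adjoin (2 * pi) theta) ->
  multiplicatively_free (fun k => expi (theta k)).
Proof.
move=> free e; under eq_bigr do rewrite -expiMz.
rewrite -expi_sum => /expi_eq1[e0 E] k.
pose coef (i : option 'I_m) : int := oapp e (- e0) i.
have /free /(_ (Some k)) : \sum_i ratr ((coef i)%:~R : rat)
    * adjoin (2 * pi) theta i = 0.
  under eq_bigr do rewrite ratr_int.
  rewrite (bigD1 None) //= (reindex_omap Some id) //=; last by case.
  by under eq_bigl do rewrite eqxx; rewrite E mulrNz mulrC mulrN addNr.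
by move=> /eqP; rewrite intr_eq0 => /eqP.
Qed.

End Angles.

(** * The monomial parametrization *)
Section Denominators.
Variables (m n : nat) (c : 'I_n -> rat) (b : 'I_m -> 'I_n -> rat).
Local Notation d := (denom_lcm c b).

Lemma numq_mul_multiple (k : nat) (x : rat) :
  (`|denq x| %| k)%N -> k%:R * x = (numq (k%:R * x))%:~R.
Proof.
move=> /dvdnP[j ->].
have -> : (j * `|denq x|)%:R * x = (j%:Z * numq x)%:~R :> rat.
  by rewrite intrM numqE natrM [X in _ * X * _]pmulrn absz_denq -pmulrn -mulrA [x * _]mulrC.
by rewrite numq_int.
Qed.

Lemma dvdn_biglcm (I : finType) (F : I -> nat) i :
  (F i %| \big[lcmn/1%N]_i F i)%N.
Proof. by rewrite (bigD1 i) //= dvdn_lcml. Qed.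

Lemma denom_lcm_gt0 : (0 < d)%N.
Proof.
apply: (big_ind (fun l => 0 < l)%N) => // [x y x0 y0|j _]; first by rewrite lcmn_gt0 x0.
rewrite lcmn_gt0 absz_gt0 denq_neq0 /=.
apply: (big_ind (fun l => 0 < l)%N) => // [x y x0 y0|k _]; first by rewrite lcmn_gt0 x0.
by rewrite absz_gt0 denq_neq0.
Qed.

Lemma denom_lcm_c j : d%:R * c j = (numq (d%:R * c j))%:~R.
Proof.
apply: numq_mul_multiple; apply: dvdn_trans (dvdn_biglcm _ j).
exact: dvdn_lcml.
Qed.

Lemma denom_lcm_b k j : d%:R * b k j = (hcoef c b k j)%:~R.
Proof.
apply: numq_mul_multiple; apply: dvdn_trans (dvdn_biglcm _ j).
by apply: dvdn_trans (dvdn_lcmr _ _); exact: (dvdn_biglcm (fun k => `|denq (b k j)|%N)).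
Qed.

End Denominators.

Section Parametrization.
Variables (R : realType) (m n : nat) (theta : 'I_(m + n) -> R).
Variables (c : 'I_n -> rat) (b : 'I_m -> 'I_n -> rat).
Local Notation C := R[i].
Local Notation d := (denom_lcm c b).
Local Notation w := (fun k : 'I_m => expi (theta (lshift n k)) : C).

(** Integer powers on the circle, written without inverses so as to remain
    within the polynomials in z and conj z. *)
Definition star_expz (e : int) (z : C) : C :=
  if e is Posz k then z ^+ k else conjc z ^+ `|e|.

Lemma star_expzE e z : `|z| = 1 -> star_expz e z = z ^ e.
Proof. by case: e => k z1 //=; rewrite conjc_unit // exprVn. Qed.

(** The i-th coordinate of nu^a M(V), with M the monomial map of Z_theta. *)
Definition param (a : nat) (i : 'I_(m + n)) (V : 'I_m -> C) : C :=
  expi (theta i) ^+ a *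
  match fintype.split i with
  | inl k => V k ^+ d
  | inr j => \prod_(k < m) star_expz (hcoef c b k j) (V k)
  end.

Lemma star_param a i : star_poly (param a i).
Proof.
apply: star_mul; first exact: star_cst.
case: (fintype.split i) => [k|j]; first by apply: star_exp; exact: star_coord.
apply: star_prod => k; case: (hcoef c b k j) => e /=; apply: star_exp.
  exact: star_coord.
exact: star_conj_coord.
Qed.

Lemma paramE a V : unitary V ->
  pow_mul (nu theta) a (torus_monomials c b V) = [ffun i => param a i V].
Proof.
move=> VU; apply/ffunP => i; rewrite !ffunE /param; congr (_ * _).
case: (fintype.split i) => [k //|j].
by apply: eq_bigr => k _; rewrite star_expzE.
Qed.

Lemma torus_param a V : unitary V -> torus [ffun i => param a i V].
Proof.
move=> VU i; rewrite ffunE normrM normrX expi_unit expr1n mul1r.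
case: (fintype.split i) => [k|j]; first by rewrite normrX VU expr1n.
rewrite normr_prod big1 // => k _.
by rewrite star_expzE // norm_expz_unit.
Qed.

Hypothesis theta_dep : forall j : 'I_n,
  theta (rshift m j) =
    2 * pi * ratr (c j) + \sum_(k < m) ratr (b k j) * theta (lshift n k).

(** Multiplying the relation for theta_(m + j) by d makes its coefficients
    integers, and the multiple of 2 pi disappears in the exponential. *)
Lemma expi_theta_dep j :
  expi (theta (rshift m j)) ^+ d = \prod_(k < m) w k ^ hcoef c b k j.
Proof.
rewrite -expiMn theta_dep mulrDl expiD -mulrA.
have ratrd x : ratr x * d%:R = ratr (d%:R * x) :> R.
  by rewrite rmorphM /= ratr_nat mulrC.
rewrite ratrd denom_lcm_c ratr_int expi_2piz mul1r mulr_suml expi_sum.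
by apply: eq_bigr => k _; rewrite mulrAC ratrd denom_lcm_b ratr_int expiMz.
Qed.

Lemma line_param a q :
  [ffun i => expi (theta i * (a + d * q)%:R)] =
  [ffun i => param a i (fun k => w k ^+ q)].
Proof.
have wU : unitary (fun k => w k ^+ q).
  by move=> k; rewrite normrX expi_unit expr1n.
apply/ffunP => i; rewrite !ffunE /param expiMn exprD; congr (_ * _).
rewrite exprM; case: split_ordP => [k ->|j ->]; first by rewrite exprAC.
rewrite expi_theta_dep -prodrXl; apply: eq_bigr => k _.
by rewrite star_expzE // !exprnP exprzAC.
Qed.

End Parametrization.

(** * Frequencies along residue classes *)
Section ResidueClasses.
Variables (R : realType) (A : pred nat) (d : nat).
Hypothesis d_gt0 : (0 < d)%N.
Local Notation U n := (\sum_(k < n) (A k)%:R : R).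

Let count_sum n : (count A (iota 1 n))%:R = U n.+1 - (A 0)%:R.
Proof.
elim: n => [|n IH]; first by rewrite big_ord1 subrr.
rewrite big_ord_recr -[n.+1 in LHS]addn1 iotaD count_cat natrD IH /= addn0 add1n.
by rewrite addrAC.
Qed.

Let sum_bounds n j : U n <= U (n + j) <= U n + j%:R.
Proof.
rewrite big_split_ord /= lerDl lerD2l sumr_ge0 //=.
rewrite -[X in _ <= X%:R]card_ord -sumr_const; apply: ler_sum => i _.
by case: (A _).
Qed.

Let sum_residues N :
  U (d * N)%N = \sum_(a < d) \sum_(q < N) (A (a + d * q)%N)%:R.
Proof.
elim: N => [|N IH].
  by rewrite muln0 big_ord0 big1 // => a _; rewrite big_ord0.
rewrite mulnSr big_split_ord /= IH -big_split /=; apply: eq_bigr => a _.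
by rewrite big_ord_recr /= [(a + _)%N]addnC.
Qed.

(** With N the quotient by d of the integral part of X, the count up to X and
    the sum over k < d N differ by at most d, and the latter splits into d sums
    of N terms. *)
Lemma residue_frequency (p : 'I_d -> R) :
  (forall a : 'I_d, forall eps : R, 0 < eps -> exists N0, forall N, (N0 <= N)%N ->
    `|\sum_(q < N) (A (a + d * q)%N)%:R - N%:R * p a| <= N%:R * eps) ->
  (fun X : R => X^-1 * (count_upto A X)%:R) @ +oo --> d%:R^-1 * \sum_(a < d) p a.
Proof.
move=> hp; apply/cvgrPdist_le => eps eps0.
have e2 : 0 < eps / 2 by rewrite divr_gt0.
have [N0 hN0] := choice (fun a => hp a _ e2).
set L' := \sum_(a < d) p a; pose L := d%:R^-1 * L'; rewrite -/L.
have dR : 0 < d%:R :> R by rewrite ltr0n.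
have L'E : L' = d%:R * L by rewrite mulVKf // gt_eqF.
pose N1 := (\max_a N0 a)%N.
(* The first bound ensures N >= N1; the second one absorbs the error
   d (|L| + 1) that comes from X - d N and from the incomplete last period. *)
exists (Num.max (d%:R * N1.+1%:R) (2 * d%:R * (`|L| + 1) / eps)).
split; first exact: num_real.
move=> X; rewrite gt_max => /andP[XN1 XL].
have X0 : 0 < X by apply: le_lt_trans XN1; rewrite mulr_ge0.
pose n := Num.truncn X; pose N := (n %/ d)%N.
have /andP[nX Xn] : n%:R <= X < n.+1%:R by apply: truncn_itv; exact: ltW.
have nE : n = (d * N + n %% d)%N by rewrite mulnC -divn_eq.
have rd : (n %% d < d)%N by rewrite ltn_mod.
have dNX : d%:R * N%:R <= X.
  by apply: le_trans nX; rewrite -natrM ler_nat [leqRHS]nE leq_addr.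
have XdN : X <= d%:R * N%:R + d%:R.
  apply: ltW; apply: lt_le_trans Xn _; rewrite -natrM -natrD ler_nat [in leqLHS]nE.
  by rewrite -addnS leq_add2l.
have N1N : (N1 <= N)%N.
  apply: ltnW; rewrite -ltnS -(ltr_nat R) -(ltr_pM2l dR) (lt_le_trans XN1) //.
  by rewrite mulrS mulrDr mulr1 addrC.
have UN : `|U (d * N)%N - N%:R * L'| <= N%:R * (d%:R * (eps / 2)).
  rewrite sum_residues /L' mulr_sumr -sumrB (le_trans (ler_norm_sum _ _ _)) //.
  have -> : N%:R * (d%:R * (eps / 2)) = \sum_(a < d) N%:R * (eps / 2).
    by rewrite sumr_const card_ord -[RHS]mulr_natl mulrCA.
  apply: ler_sum => a _; apply: hN0; apply: leq_trans N1N.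
  exact: (leq_bigmax a).
have UT : `|(count_upto A X)%:R - U (d * N)%N| <= d%:R.
  rewrite count_sum -/n.
  have /andP[b1 b2] := sum_bounds (d * N) (n %% d).+1.
  rewrite addnS -nE in b1 b2.
  have rd1 : (n %% d).+1%:R <= d%:R :> R by rewrite ler_nat.
  have A01 : (0 <= (A 0)%:R :> R) && ((A 0)%:R <= 1 :> R) by case: (A 0); rewrite ?ler01 lexx ?ler01.
  have d1 : 1 <= d%:R :> R by rewrite ler1n.
  by move: A01 => /andP[A0 A1]; rewrite ler_norml; apply/andP; split; lra.
have -> : L - X^-1 * (count_upto A X)%:R =
    X^-1 * ((X - d%:R * N%:R) * L - (U (d * N)%N - N%:R * L')
            - ((count_upto A X)%:R - U (d * N)%N)).
  by rewrite L'E; field; rewrite gt_eqF.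
rewrite normrM gtr0_norm ?invr_gt0 // ler_pdivrMl //.
have XL1 : `|(X - d%:R * N%:R) * L| <= d%:R * `|L|.
  rewrite normrM ler_wpM2r // ger0_norm ?subr_ge0 //; lra.
have XL2 : 2 * d%:R * (`|L| + 1) <= X * eps.
  by rewrite -ler_pdivrMr // ltW.
have XN2 : N%:R * (d%:R * (eps / 2)) <= X * (eps / 2).
  by rewrite mulrA ler_pM2r // mulrC.
rewrite (le_trans (ler_normB _ _)) // (le_trans (lerD (ler_normB _ _) UT)) //.
by rewrite (le_trans (lerD (lerD XL1 UN) (lexx _))) //; lra.
Qed.

End ResidueClasses.

(** * Simultaneous positivity of trigonometric polynomials *)
Section GenericCase.
Variables (R : realType) (m : nat).
Variables (dO : measure_display) (Omega : measurableType dO).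
Variables (P : probability Omega R) (W : 'I_m -> Omega -> R[i]).
Hypothesis W_unif : forall k, uniform_on_circle P (W k).
Hypothesis W_indep : independent_family P W.
Variable t : 'I_m -> R.
Let w k := expi (t k).
Hypothesis w_free : multiplicatively_free w.

Lemma bigmin_gt0 (I : finType) (F : I -> R) :
  (0 < \big[Num.min/1]_i F i) = [forall i, 0 < F i].
Proof.
apply/idP/forallP => [/bigmin_gtP[_ h] i|h]; first exact: h.
by apply/bigmin_gtP; split => // i _; exact: h.
Qed.

(** Either some normal form is zero, and then both sides vanish, or the product
    of the normal forms is a nonzero polynomial that vanishes wherever the
    minimum g does. *)
Lemma positivity_frequency (I : finType) (h : I -> ('I_m -> R[i]) -> R[i])
    (eps : R) : (forall i, star_poly (h i)) -> 0 < eps ->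
  exists N0, forall N, (N0 <= N)%N ->
  `|\sum_(q < N) [forall i, 0 < complex.Re (h i (fun k => w k ^+ q))]%:R -
    N%:R * fine (P [set x | [forall i, 0 < complex.Re (h i (W ^~ x))]])|
  <= N%:R * eps.
Proof.
move=> sh eps0.
have WU x : unitary (W ^~ x) by move=> k; case: (W_unif k).
have [s /choice[Q hQ]] := choice (fun i => star_normal_form (star_real_part (sh i))).
have [/existsP[i /eqP Qi0]|Qn0] := boolP [exists i, Q i == 0].
  have none V : unitary V -> [forall i, 0 < complex.Re (h i V)] = false.
    move=> VU; apply/negbTE; rewrite negb_forall; apply/existsP; exists i.
    have := hQ i V VU; rewrite Qi0 meval0 => /eqP.
    rewrite mulf_eq0 expf_eq0 => /orP[/andP[_ /prodf_eq0[k _]]|].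
      by rewrite (negbTE (norm1_neq0 (VU k))).
    by move=> /eqP[->]; rewrite ltxx.
  exists 0%N => N _; rewrite big1 => [|q _]; last first.
    by rewrite none // => k; rewrite normrX expi_unit expr1n.
  rewrite (_ : [set x | _] = set0) ?measure0 ?mulr0 ?subrr ?normr0.
    by rewrite mulr_ge0 // ltW.
  by apply/seteqP; split => // x /=; rewrite none.
pose g V := \big[Num.min/1]_i complex.Re (h i V).
have gE V : [forall i, 0 < complex.Re (h i V)] = (0 < g V) by rewrite bigmin_gt0.
have g_approx : trig_approximable g.
  by apply: trig_approximable_bigmin => i; exact: trig_approximable_Re.
have g_meas : measurable_fun setT (g : mcvec R m -> R).
  rewrite /g; elim: (index_enum I) => [|i l IH].
    by under eq_fun do rewrite big_nil; exact: measurable_cst.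
  under eq_fun do rewrite big_cons; apply: measurable_minr => //.
  by have /cmeasurableP[] := cmeasurable_star (@cmeasurable_coord R m) (sh i).
have g_null : P [set x | g (W ^~ x) == 0] = 0%E.
  have prodQ : \prod_i Q i != 0.
    by apply/prodf_neq0 => i _; move: Qn0; rewrite negb_exists => /forallP.
  apply: subset_measure0 (torus_zeros_negligible W_unif W_indep prodQ).
  - rewrite -[X in measurable X]setTI.
    apply: (measurable_fun_eqr (f := fun x => g (W ^~ x))) => //.
    apply: (measurableT_comp g_meas).
    by apply: measurable_cvec; exact: cmeasurable_W.
  - by apply: cmeasurable_zeros; exact: (cmeasurable_star (cmeasurable_W W_unif) (star_meval _)).
  - move=> x /= /eqP g0; rewrite rmorph_prod.
    (* The value 0 of the minimum is not the default value 1, so it is attained. *)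
have [i hi0] : exists i, complex.Re (h i (W ^~ x)) = 0.
      have : \big[Num.min/1]_i complex.Re (h i (W ^~ x)) = 1 \/ exists i, 
          \big[Num.min/1]_i complex.Re (h i (W ^~ x)) = complex.Re (h i (W ^~ x)).
        elim/big_rec: _ => [|i y _ IH]; first by left.
        by rewrite minEle; case: ifP => _ //; right; exists i.
      rewrite -/(g (W ^~ x)) g0; case=> [/esym/eqP | [ i ] ]; first by rewrite oner_eq0.
      by exists i.
    rewrite (bigD1 i) //= -hQ //; first by rewrite hi0 mulr0 mul0r.
have [N0 hN0] := visit_frequency W_unif W_indep w_free g_approx g_meas g_null eps0.
exists N0 => N /hN0; under eq_bigr do rewrite -gE.
by under eq_set do rewrite -gE.
Qed.

End GenericCase.

(** * The degenerate case *)
Section FiniteCase.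
Variables (R : realType) (n : nat) (nu : {ffun 'I_n -> R[i]}) (d : nat).
Hypothesis d_gt0 : (0 < d)%N.
Hypothesis nu_d : forall i, nu i ^+ d = 1.
Variables (dO : measure_display) (Omega : measurableType dO).
Variables (P : probability Omega R) (Z : Omega -> {ffun 'I_n -> R[i]}).
Hypothesis Z_rv : torus_rv Z.
Hypothesis Z_unif : uniform_on_finite P Z (cyclic_subgroup nu).

Let nu_pow (k : nat) : {ffun 'I_n -> R[i]} := [ffun i => nu i ^+ k].

Let Z_meas i : cmeasurable (fun x => Z x i).
Proof. by case: Z_rv => _; apply. Qed.

Let Z_fiber_meas g : measurable (Z @^-1` [set g]).
Proof.
rewrite (_ : _ @^-1` _ = \bigcap_(i in [set: 'I_n]) [set x | Z x i - g i == 0]).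
  apply: fin_bigcap_measurable => // i _; apply: cmeasurable_zeros.
  by apply: cmeasurableD => //; exact: cmeasurable_cst.
apply/seteqP; split => x /=; first by move=> <- i _ /=; rewrite subrr.
move=> h; apply/ffunP => i; apply/eqP; rewrite -subr_eq0; exact: h.
Qed.

Let G := cyclic_subgroup nu.

Let ZG_meas : measurable (Z @^-1` G).
Proof.
have [finG _] := Z_unif.
rewrite (_ : _ @^-1` _ = \bigcup_(g in G) Z @^-1` [set g]).
  by apply: fin_bigcup_measurable.
apply/seteqP; split => x /=; first by exists (Z x).
by case=> g Gg /= ->.
Qed.

Lemma prob_in_cyclic_subgroup : P (Z @^-1` G) = 1%E.
Proof.
have [finG PG] := Z_unif.
rewrite (_ : _ @^-1` _ = \bigcup_(g in G) Z @^-1` [set g]); last first.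
  apply/seteqP; split => x /=; first by exists (Z x).
  by case=> g Gg /= ->.
rewrite measure_fin_bigcup //; last first.
  by move=> g g' _ _ [x [/= <- <-]].
rewrite fsbig_finite //= (eq_big_seq (fun=> (#|` fset_set G|%:R^-1)%:E)); last first.
  by move=> g; rewrite in_fset_set // inE => /PG.
rewrite sumEFin big_const_seq count_predT iter_addr addr0 -[X in X%:E]mulr_natr mulVf //.
(* The cardinal is nonzero because nu belongs to the subgroup. *)
rewrite pnatr_eq0 cardfs_eq0; apply/eqP => G0.
have : nu \in fset_set G.
  by rewrite in_fset_set // inE; exists 1; apply/ffunP => i; rewrite ffunE expr1z.
by rewrite G0 inE.
Qed.

Lemma prob_setI_full (A B : set Omega) : measurable A -> measurable B ->
  P B = 1%E -> fine (P (A `&` B)) = fine (P A).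
Proof.
move=> mA mB PB; have PC : P (~` B) = 0%E by rewrite probability_setC // PB subee.
congr fine; apply/esym.
rewrite -[in LHS](setUIDK A B) measureU0 //; [exact: measurableI|exact: measurableD|].
apply: subset_measure0 PC; [exact: measurableD|exact: measurableC|].
by move=> x [].
Qed.

Let periodic_sum (F : nat -> R) k : (forall j, F (j + d)%N = F j) ->
  \sum_(a < d) F (a + k)%N = \sum_(a < d) F a.
Proof.
move=> Fd; elim: k => [|k IH].
  by apply: eq_bigr => a _; rewrite addn0.
rewrite -IH; case: d Fd => [|e] Fd; first by rewrite !big_ord0.
rewrite big_ord_recr [RHS]big_ord_recl /= addrC; congr (_ + _).
  by rewrite -[in RHS]Fd add0n; congr F; lia.
by apply: eq_bigr => a _; rewrite /bump /= add1n addSnnS.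
Qed.

(** When Z = nu^s, the sum over a of the indicator functions at nu^a Z runs over
    a period of a periodic sequence, so it does not depend on s.  It is thus
    almost surely constant; the events are shrunk to Z in <nu>, and enlarged by
    the complement, to get bounds that hold everywhere. *)
Lemma coset_average (b : pred {ffun 'I_n -> R[i]}) :
  (forall a : nat, measurable [set x | b (pow_mul nu a (Z x))]) ->
  \sum_(a < d) fine (P [set x | b (pow_mul nu a (Z x))]) =
  \sum_(a < d) (b (nu_pow a))%:R.
Proof.
move=> mb; have nu0 i : nu i != 0.
  by apply: contraTneq isT => nui0; have := nu_d i;
    rewrite nui0 expr0n gtn_eqF // => /esym/eqP; rewrite oner_eq0.
pose F k : R := (b (nu_pow k))%:R.
have Fd j : F (j + d)%N = F j.
  by rewrite /F /nu_pow; congr ((b _)%:R); apply/ffunP => i; rewrite !ffunE exprD nu_d mulr1.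
have coset x : G (Z x) -> \sum_(a < d) (b (pow_mul nu a (Z x)))%:R = \sum_(a < d) F a.
  move=> [s ->]; rewrite -(periodic_sum `|(s %% d)%Z| Fd); apply: eq_bigr => a _.
  congr ((b _)%:R); apply/ffunP => i; rewrite !ffunE exprD; congr (_ * _).
  rewrite [in LHS](divz_eq s d) expfzDr // -exprz_exp exprzAC -exprnP nu_d exp1rz mul1r.
  by rewrite exprnP gez0_abs // modz_ge0 // -lt0n.
have inG x : `[< G (Z x) >] = true -> G (Z x) by move/asboolP.
have PG := prob_in_cyclic_subgroup.
have PGm a : measurable [set x | b (pow_mul nu a (Z x)) && `[< G (Z x) >] ].
  rewrite (_ : [set x | _] = [set x | b (pow_mul nu a (Z x))] `&` Z @^-1` G).
    exact: measurableI.
  by apply/seteqP; split => x /=; [move=> /andP[-> /asboolP]|move=> [-> /asboolP ->]].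
have PGm' a : measurable [set x | b (pow_mul nu a (Z x)) || ~~ `[< G (Z x) >] ].
  rewrite (_ : [set x | _] = [set x | b (pow_mul nu a (Z x))] `|` ~` (Z @^-1` G)).
    by apply: measurableU => //; exact: measurableC.
  apply/seteqP; split => x /=; first by move=> /orP[->|/asboolPn]; [left|right].
  by move=> [->|/asboolPn ->] //; rewrite orbT.
apply/eqP; rewrite eq_le; apply/andP; split.
- rewrite (eq_bigr (fun a : 'I_d => fine (P [set x | b (pow_mul nu a (Z x)) && `[< G (Z x) >]]))).
    apply: (@sum_prob_le _ _ _ P d (fun a x => b (pow_mul nu a (Z x)) && `[< G (Z x) >])) => //.
      by rewrite sumr_ge0.
    move=> x; case: asboolP => [/coset <-|_].
      by under eq_bigr do rewrite andbT.
    by rewrite big1 ?sumr_ge0 // => a _; rewrite andbF.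
  move=> a _; rewrite -(prob_setI_full (mb a) ZG_meas PG); congr (fine (P _)).
  by apply/seteqP; split => x /=; [move=> [-> /asboolP ->]|move=> /andP[-> /asboolP]].
- rewrite [leRHS](eq_bigr (fun a : 'I_d => fine (P [set x | b (pow_mul nu a (Z x)) || ~~ `[< G (Z x) >]]))).
    apply: (@sum_prob_ge _ _ _ P d (fun a x => b (pow_mul nu a (Z x)) || ~~ `[< G (Z x) >])) => //.
    move=> x; case: asboolP => [/coset <-|_].
      by under [leRHS]eq_bigr do rewrite orbF.
    by apply: ler_sum => a _; rewrite orbT; case: (b _).
  move=> a _; rewrite -(prob_setI_full (mb a) ZG_meas PG) -(prob_setI_full (PGm' a) ZG_meas PG).
  congr (fine (P _)); apply/seteqP; split => x /= [bx Gx]; split => //.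
    by rewrite bx.
  by move: bx; rewrite (asboolT Gx) orbF.
Qed.

End FiniteCase.

(** * Conclusion *)
Lemma along_line_param (R : realType) (m n : nat) (theta : 'I_(m + n) -> R)
    (c : 'I_n -> rat) (b : 'I_m -> 'I_n -> rat) (f : ratfun R (m + n)) a q :
  (forall j : 'I_n, theta (rshift m j) =
     2 * pi * ratr (c j) + \sum_(k < m) ratr (b k j) * theta (lshift n k)) ->
  along_line f theta (a + denom_lcm c b * q)%:R =
  rat_eval f [ffun i => param theta c b a i (fun k => expi (theta (lshift n k)) ^+ q)].
Proof. by move=> dep; rewrite /along_line line_param. Qed.

Theorem theorem1p5 (R : realType) (m n D : nat)
    (theta : 'I_(m + n) -> R) (c : 'I_n -> rat) (b : 'I_m -> 'I_n -> rat)
    (theta_basis :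
      Q_basis (adjoin (2 * pi) (fun k : 'I_m => theta (lshift n k)))
              (Q_span (adjoin pi theta)))
    (theta_dep : forall j : 'I_n,
      theta (rshift m j) =
        2 * pi * ratr (c j) + \sum_(k < m) ratr (b k j) * theta (lshift n k))
    (dO : measure_display) (Omega : measurableType dO)
    (P : probability Omega R)
    (Z : Omega -> {ffun 'I_(m + n) -> complex.complex R})
    (Z_theta : is_Z_theta P theta c b Z)
    (f : 'I_D -> ratfun R (m + n))
    (f_no_pole : forall j, no_pole_on_torus (f j))
    (f_real : forall j, real_on_torus (f j)) :
  (fun X : R =>
     X^-1 * (count_upto
       (fun k : nat => decreasing_chain (fun j => along_line (f j) theta k%:R))
       X)%:R) @ +oo -->
  (denom_lcm c b)%:R^-1 *
    \sum_(a < denom_lcm c b)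
      fine (P [set w | decreasing_chain
                         (fun j => rat_eval (f j) (pow_mul (nu theta) a (Z w)))]).
Proof.
have [h sh hE] := chain_positivity f_no_pole f_real.
have [theta_free _] := theta_basis.
have d0 := denom_lcm_gt0 c b.
have chain_line (a q : nat) :
  decreasing_chain (fun j => along_line (f j) theta (a + denom_lcm c b * q)%:R) =
  [forall p, 0 < complex.Re (h p
     (fun i => param theta c b a i (fun k => expi (theta (lshift n k)) ^+ q)))].
  rewrite (_ : (fun j => along_line _ _ _) = (fun j => rat_eval (f j) [ffun i =>
    param theta c b a i (fun k => expi (theta (lshift n k)) ^+ q)])); last first.
    by apply/funext => j; exact: along_line_param.
  rewrite hE; last by apply: torus_param => k; rewrite normrX expi_unit expr1n.
  apply: eq_forallb => p; congr (0 < complex.Re (h p _)).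
  by apply/funext => i; rewrite ffunE.
move: Z_theta; rewrite /is_Z_theta; case: eqVneq => [m0|mN0].
- move=> [Z_rv Z_unif]; subst m.
  have nu_d i : nu theta i ^+ denom_lcm c b = 1.
    rewrite ffunE; case: (split_ordP i) => [[] //|j ->].
    by rewrite (expi_theta_dep theta_dep) big_ord0.
  pose chain (z : {ffun 'I_(0 + n) -> R[i]}) :=
    decreasing_chain (fun j => rat_eval (f j) z).
  rewrite (coset_average d0 nu_d Z_rv Z_unif (b := chain)); last first.
    move=> a; rewrite (_ : [set x | _] = \bigcap_(p in [set: 'I_D * 'I_D])
        [set x | 0 < complex.Re (h p (pow_mul (nu theta) a (Z x)))]).
      apply: fin_bigcap_measurable => // p _; rewrite -[X in measurable X]setTI.
      apply: (measurable_fun_ltr (f := fun=> 0)) => //.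
      have /cmeasurableP[//] : cmeasurable (fun x => h p (pow_mul (nu theta) a (Z x))).
      apply: cmeasurable_star => // i; under eq_fun do rewrite ffunE.
      by apply: cmeasurableM; [exact: cmeasurable_cst|case: Z_rv => _; apply].
    have T x : torus (pow_mul (nu theta) a (Z x)).
      move=> i; rewrite !ffunE normrM normrX expi_unit expr1n mul1r.
      by case: Z_rv => + _; apply.
    apply/seteqP; split => x /=; rewrite /chain hE //.
      by move=> /forallP hx p _; exact: hx.
    by move=> hx; apply/forallP => p; exact: hx.
  apply: residue_frequency => // a eps eps0; exists 0%N => N _.
  have chain_period (q : nat) :
      decreasing_chain (fun j => along_line (f j) theta (a + denom_lcm c b * q)%:R) =
      chain [ffun i => nu theta i ^+ a].
    congr (decreasing_chain _); apply/funext => j; congr (rat_eval _ _).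
    apply/ffunP => i; rewrite !ffunE expiMn exprD exprM.
    by have := nu_d i; rewrite ffunE => ->; rewrite expr1n mulr1.
  under eq_bigr do rewrite chain_period.
  rewrite sumr_const card_ord -[X in `|X - _|]mulr_natl subrr normr0.
  by rewrite mulr_ge0 // ltW.
- move=> [W [W_unif W_indep ZW]].
  have w_free := Q_free_multiplicatively_free theta_free.
  have WU x : unitary (W ^~ x) by move=> k; case: (W_unif k).
  apply: residue_frequency => // a eps eps0.
  have [|N0 hN0] := positivity_frequency W_unif W_indep w_free
    (h := fun p V => h p (fun i => param theta c b a i V)) _ eps0.
    by move=> p; apply: star_comp => // i; exact: star_param.
  exists N0 => N /hN0; under eq_bigr do rewrite -chain_line.
  rewrite (_ : [set x | _] = [set x | decreasing_chain
    (fun j => rat_eval (f j) (pow_mul (nu theta) a (Z x)))]) //.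
  apply: eq_set => x; rewrite ZW paramE // hE; last exact: torus_param.
  congr (is_true _); apply: eq_forallb => p; congr (0 < complex.Re (h p _)).
  by apply/funext => i; rewrite ffunE.
Qed.
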